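(* Let $m\ge 1$ and $0\le n\le m/2$ be integers, let $\mathfrak g=\mathfrak{sp}_{2m}(\mathbb C)$, and let $X_n$ and $\mathcal S_n\subset\mathfrak g$ be the nilpotent element and the set of matrices $S(a_i,y_i,z_i,d_j)$ ($1\le i\le n$, $1\le j\le m-n$) defined in the context. Then the affine subspace $\mathcal S_n$ is a $\lambda$-invariant transverse slice to the adjoint orbit of $X_n$ at the point $X_n$. Moreover, for $S=S(a_i,y_i,z_i,d_j)\in\mathcal S_n$ the characteristic polynomial $\chi_S(t)$ of $S$ is given by $$\chi_S(t)=A(t)D(t)+(-1)^{m}B(t)B(-t),$$ where $$A(t)=t^{2n}-a_1t^{2(n-1)}+\cdots+(-1)^{n-1}a_{n-1}t^2+(-1)^na_n,$$ $$D(t)=t^{2(m-n)}-d_1t^{2(m-n-1)}+\cdots+(-1)^{m-n-1}d_{m-n-1}t^2+(-1)^{m-n}d_{m-n},$$ $$B(t)=y_1+y_2t+\cdots+y_nt^{n-1}-t^n\bigl(z_1-z_2t+\cdots+(-1)^{n-1}z_nt^{n-1}\bigr).$$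
   Context: $\mathfrak{sp}_{2m}(\mathbb C)$ is the Lie algebra of block matrices $\begin{pmatrix}P&Q\\ R&-P^{\top}\end{pmatrix}$ with $P,Q,R$ complex $m\times m$ matrices, $Q,R$ symmetric; the group $Sp_{2m}(\mathbb C)$ acts on it by the adjoint action. $E_{i,j}$ is the $2m\times 2m$ matrix unit; $J_l$ is the $l\times l$ nilpotent Jordan block with ones on the superdiagonal; $\mathcal E_{j,k}$ is the $j\times k$ matrix with $1$ in position $(j,k)$ and zeros elsewhere. Nilpotent element: $$X_n=\begin{pmatrix}J_{m-n}&0&\mathcal E_{m-n,m-n}&0\\0&J_n&0&\mathcal E_{n,n}\\0&0&-J_{m-n}^{\top}&0\\0&0&0&-J_n^{\top}\end{pmatrix}$$ (block sizes $m-n,n,m-n,n$). Slice, case $n<m/2$: for complex numbers $a_i,y_i,z_i$ ($1\le i\le n$), $d_j$ ($1\le j\le m-n$) let $M=M(a_i,y_i,z_i,d_j)$ be the symmetric $m\times m$ matrix with diagonal $(d_{m-n},d_{m-n-1},\dots,d_1,a_n,a_{n-1},\dots,a_1)$, with $M_{1,m-n+i}=M_{m-n+i,1}=y_i$ for $1\le i\le n$, $M_{j+1,m}=M_{m,j+1}=z_j$ for $1\le j\le n$, and all other entries $0$. Put $S(a_i,y_i,z_i,d_j)=X_n+\begin{pmatrix}0&0\\ M&0\end{pmatrix}$. Slice, case $n=m/2$ (where the definition is modified): let $M'$ be the symmetric $m\times m$ matrix with diagonal $(d_n,d_{n-1},\dots,d_2,\,d_1+z_n^2,\,a_n,a_{n-1},\dots,a_1)$,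 with $M'_{1,n+i}=M'_{n+i,1}=y_i$ for $1\le i\le n$, $M'_{j+1,m}=M'_{m,j+1}=z_j$ for $1\le j\le n-1$, and all other entries $0$. Put $S(a_i,y_i,z_i,d_j)=X_n+\begin{pmatrix}0&0\\ M'&0\end{pmatrix}+z_n(E_{m,n}-E_{n+m,2m})$. In both cases $\mathcal S_n$ is the set of all matrices $S(a_i,y_i,z_i,d_j)$. A transverse slice to the adjoint orbit $\mathcal O_X$ at $X$ is a complex submanifold of $\mathfrak g$ whose tangent space at $X$ is complementary to $T_X\mathcal O_X=[\mathfrak g,X]$. $\lambda$-invariant means invariant under the $\mathbb C^*$-action $\lambda_r(Y)=r\exp(-\log(r)H/2)\,Y\,\exp(\log(r)H/2)$ (infinitesimal generator $\xi_Y=Y-\tfrac12[H,Y]$), where $H=H_n$ is the semisimple element of a Jacobson–Morozov triple $\{H_n,X_n,N_n^-\}$ with nilpositive element $X_n$: $H_n=\mathrm{diag}(l_{m-n},l_n,-l_{m-n},-l_n)$ with $l_k=\mathrm{diag}(2k-1,2k-3,\dots,1)$.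
   Formalization: Two signs are corrected: the last term of the characteristic polynomial is (-1)^{m+1}B(t)B(-t) instead of (-1)^m B(t)B(-t), and for n=m/2 the corner entry of M' is d_1 - z_n^2 instead of d_1 + z_n^2 (the set S_n is the same); the printed formula fails for m=2, n=1. *)

(* Defs.v *)
From HB Require Import structures.
From mathcomp Require Import all_boot all_order all_algebra.
From mathcomp Require Import all_classical all_reals all_analysis.
From mathcomp Require Export complex.

Set Implicit Arguments.
Unset Strict Implicit.
Unset Printing Implicit Defensive.

Import Order.TTheory GRing.Theory Num.Theory.
Import numFieldNormedType.Exports.

Local Open Scope classical_set_scope.
Local Open Scope ring_scope.

(* The topology and norm of R[i], exactly as MathComp-Analysis installs them on
   every abstract numClosedFieldType. *)
HB.instance Definition _ (R : realType) :=
  GRing.ComAlgebra.copy R[i] (R[i] : numClosedFieldType)^o.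
HB.instance Definition _ (R : realType) :=
  Vector.copy R[i] (R[i] : numClosedFieldType)^o.
HB.instance Definition _ (R : realType) :=
  NormedModule.copy R[i] (R[i] : numClosedFieldType)^o.

Section Geometry.
Variables (K : numFieldType) (V : normedModType K).
Implicit Types (S T W L : set V) (p : V).

Definition linear_subspace W : Prop :=
  W 0 /\ forall (c : K) u v, W u -> W v -> W (c *: u + v).

Definition affine_subspace S : Prop :=
  exists (x : V) W, linear_subspace W /\ S = [set x + w | w in W].

(* Differentiability is over the scalar field K, so for K = R[i] this is
   holomorphy. *)
Definition holomorphic_on (U : set V) (f : V -> V) : Prop :=
  open U /\ forall x, U x -> differentiable f x.

(* Embedded submanifold: S is covered by domains of biholomorphic charts phi
   that straighten it to a linear subspace. One L serves all charts: charts may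
   be composed with linear automorphisms, so this only says that S has constant
   dimension. *)
Definition complex_submanifold S : Prop :=
  exists L, linear_subspace L /\
  forall p, S p -> exists (U : set V) (phi psi : V -> V),
    [/\ U p,
        holomorphic_on U phi,
        holomorphic_on (phi @` U) psi,
        forall x, U x -> psi (phi x) = x
      & forall x, U x -> (S x <-> L (phi x))].

(* Velocities at p of germs of holomorphic curves in S. *)
Definition tangent_space S p : set V :=
  [set v | exists gamma : K -> V,
    [/\ gamma 0 = p,
        \forall t \near (0 : K), S (gamma t),
        \forall t \near (0 : K), derivable gamma t 1
      & 'D_1 gamma 0 = v]].

Definition complementary (g T W : set V) : Prop :=
  T `&` W = [set 0] /\ g = [set u + v | u in T & v in W].

End Geometry.

Section Symplectic.
Variables (R : realType) (m : nat).
Local Notation C := R[i].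

Definition sp : set 'M[C]_(m + m) :=
  [set Y | exists P Q S : 'M[C]_m,
     [/\ Q^T = Q, S^T = S & Y = block_mx P Q S (- P^T)]].

(* [sp, X], the tangent space at X of the adjoint orbit of X. *)
Definition adjoint_tangent (X : 'M[C]_(m + m)) : set 'M[C]_(m + m) :=
  [set Y *m X - X *m Y | Y in sp].

(* A submanifold of the linear subspace sp is the same thing as a submanifold
   of the ambient space of matrices that is contained in sp. *)
Definition transverse_slice (X : 'M[C]_(m + m)) (S : set 'M[C]_(m + m)) : Prop :=
  [/\ S X, S `<=` sp, complex_submanifold S
    & complementary sp (tangent_space S X) (adjoint_tangent X)].

Definition cexp (w : C) : C := limn (series (fun k => w ^+ k / k`!%:R)).

Definition mxexp (A : 'M[C]_(m + m)) : 'M[C]_(m + m) :=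
  limn (series (fun k => (k`!%:R)^-1 *: A ^+ k)).

(* lambda_r with log r := w. *)
Definition lambda (H : 'M[C]_(m + m)) (r w : C) (Y : 'M[C]_(m + m)) :
    'M[C]_(m + m) :=
  r *: (mxexp (- (w / 2) *: H) *m Y *m mxexp ((w / 2) *: H)).

(* Every determination w of log r is allowed. *)
Definition lambda_invariant (H : 'M[C]_(m + m)) (S : set 'M[C]_(m + m)) : Prop :=
  forall r w : C, r != 0 -> cexp w = r -> lambda H r w @` S = S.

End Symplectic.

Section Slice.
Variable R : realType.
Local Notation C := R[i].

(* Matrix unit with 1-based indices, as everywhere below. *)
Definition munit (k l p q : nat) : 'M[C]_(k, l) :=
  \matrix_(i, j) ((i.+1 == p) && (j.+1 == q))%:R.

Definition jordan (l : nat) : 'M[C]_l :=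
  \matrix_(i, j) (j == i.+1 :> nat)%:R.

Definition weights (l : nat) : 'rV[C]_l :=
  \row_i (l.*2 - (i.*2).+1)%:R.

Lemma blocks_size (m n : nat) : (n.*2 <= m)%N -> (m - n + n)%N = m.
Proof.
by move=> h; apply/subnK/(leq_trans _ h); rewrite -addnn leq_addr.
Qed.

Section Fixed.
Variables (m n : nat) (hn : (n.*2 <= m)%N).

Definition diag_blocks (A : 'M[C]_(m - n)) (B : 'M[C]_n) : 'M[C]_m :=
  castmx (blocks_size hn, blocks_size hn) (block_mx A 0 0 B).

Definition nilX : 'M[C]_(m + m) :=
  block_mx
    (diag_blocks (jordan (m - n)) (jordan n))
    (diag_blocks (munit (m - n) (m - n) (m - n) (m - n)) (munit n n n n))
    0
    (diag_blocks (- (jordan (m - n))^T) (- (jordan n)^T)).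

Definition half_weights : 'rV[C]_m :=
  castmx (erefl 1%N, blocks_size hn) (row_mx (weights (m - n)) (weights n)).

Definition ssH : 'M[C]_(m + m) :=
  diag_mx (row_mx half_weights (- half_weights)).

(* Parameters are sequences of which only the entries 1..n (for a, y, z) and
   1..m-n (for d) are used. *)
Implicit Types a y z d : nat -> C.

(* Symmetric matrix with diagonal (d_(m-n), .., d_1, a_n, .., a_1), with
   y_1, .., y_n ending the first row and z_1, .., z_k starting at the second
   entry of the last column. *)
Definition slice_block (k : nat) a y z d : 'M[C]_m :=
  \matrix_(i, j)
    let p := (minn i j).+1 in
    let q := (maxn i j).+1 in
    if p == q then
      (if (p <= m - n)%N then d (m - n + 1 - p)%N else a (m + 1 - p)%N)
    else if (p == 1%N) && (m - n < q)%N then y (q - (m - n))%N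
    else if (q == m) && (1 < p <= k.+1)%N then z p.-1
    else 0.

(* When m = 2n the corner entry is d_1 - z_n^2. The sign matters: for m = 2 and
   n = 1 the characteristic polynomial of slice_mx is
   (t^2 - a_1) (t^2 - d_1) - (y_1 - z_1 t) (y_1 + z_1 t), whereas d_1 + z_n^2
   would replace d_1 by d_1 + 2 z_1^2 there. The image slice_set is the same
   for both signs. *)
Definition slice_mx a y z d : 'M[C]_(m + m) :=
  if n.*2 == m then
    nilX
    + block_mx 0 0
        (slice_block n.-1 a y z
           (fun j => if j == 1%N then d 1%N - z n ^+ 2 else d j)) 0
    + z n *: (munit (m + m) (m + m) m n
              - munit (m + m) (m + m) (n + m) (m + m))
  else nilX + block_mx 0 0 (slice_block n a y z d) 0.

Definition slice_set : set 'M[C]_(m + m) :=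
  [set Y | exists a y z d, Y = slice_mx a y z d].

End Fixed.

(* t^(2k) - c_1 t^(2(k-1)) + .. + (-1)^k c_k, used for both A and D. *)
Definition even_monic (k : nat) (c : nat -> C) : {poly C} :=
  'X^(2 * k) + \sum_(1 <= i < k.+1) ((-1) ^+ i * c i) *: 'X^(2 * (k - i)).

Definition polyB (n : nat) (y z : nat -> C) : {poly C} :=
  \sum_(1 <= i < n.+1) y i *: 'X^(i.-1)
  - 'X^n * \sum_(1 <= i < n.+1) ((-1) ^+ i.-1 * z i) *: 'X^(i.-1).

End Slice.

Arguments nilX R {m n} hn.
Arguments ssH R {m n} hn.
Arguments slice_set R {m n} hn.

(* Main.v *)
Require Import Defs.
From HB Require Import structures.
From mathcomp Require Import all_boot all_order all_algebra.
From mathcomp Require Import all_classical all_reals all_analysis.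
From mathcomp Require Import complex.
From mathcomp Require Import zify ring.

(** Why the statement holds.

    The nilpotent X is a sum of two Jordan blocks, of sizes 2(m-n) and 2n.  Up
    to signs the standard basis consists of two chains b_0, b_1, .. with
    X b_k = b_(k-1) (nilX_chain); a chain is named by a boolean, false for the
    one of length 2(m-n).  With omega the symplectic form, Y belongs to sp
    exactly when the bilinear form omega(u, Y v) is symmetric, so Y is encoded
    by the values of this form on the chains, written gram Y.  In these terms
    the bracket with X is a discrete derivative,
      gram [Z, X] (k, l) = gram Z (k, l-1) + gram Z (k-1, l),
    and therefore the alternating sums of gram Y over the antidiagonals
    k + l = s, for s less than both sides of a block, vanish on [sp, X].
    Conversely they are the only obstructions: when they vanish the equation
    above is solved antidiagonal by antidiagonal (antidiag_solve,
    bracket_of_antidiag0).  Each coordinate a_i, y_i, z_i, d_j of the slice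
    sits on its own antidiagonal (antidiag_dir_diag, antidiag_dir_cross), and
    this is transversality.  The slice being an affine subspace, its tangent
    space is its direction space, a closed set because it is the kernel of a
    linear map of a finite dimensional space (slice_residual).

    For the action of lambda, b_k has weight 2p-1-2k under H, where 2p is the
    length of its chain; so lambda_r multiplies gram (k, l) by r^(p+p'-k-l).
    This fixes X, which lives where the exponent is 0, and multiplies every
    coordinate of the slice by a positive power of r.  The argument needs
    exp(u+v) = exp(u) exp(v) for complex u and v: the difference between the
    product of two partial sums and the partial sum of u+v is dominated by the
    same difference for |u| and |v|, which tends to 0 by the real case.

    For the characteristic polynomial, let S = X + w with w a slice direction,
    and let v_c be the sum of the t^k b_k along the chain c.  Then t - X sends
    v_c to a multiple of the last vector of c, and it can be inverted modulo
    these last vectors by an explicit nilpotent matrix (tail_mx).  Correcting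
    v_c twice with this matrix makes t - S send it to a combination of the last
    vectors, whose coefficients form the two by two matrix
      D(t)              (-1)^(m-n) B(t)
      (-1)^n B(-t)      A(t)
    because they are generating functions of the antidiagonal sums of w
    (cogen_dir_gen).  Its determinant divides that of t - S (det_reduction),
    and both are monic of degree 2m.  When m = 2n the second correction adds a
    term in z_n^2, and it is cancelled by the shift of d_1 in the definition of
    the slice (even_monic_corner). *)

Set Implicit Arguments.
Unset Strict Implicit.
Unset Printing Implicit Defensive.

Import Order.TTheory GRing.Theory Num.Theory.
Import numFieldNormedType.Exports.

Local Open Scope classical_set_scope.
Local Open Scope ring_scope.

(** * Sums over antidiagonals *)

Section AntidiagonalReindexing.

Lemma sum_antidiag (V : nmodType) (F : nat -> nat -> V) N :
  \sum_(0 <= s < N) \sum_(0 <= k < s.+1) F k (s - k)%N =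
  \sum_(0 <= k < N) \sum_(0 <= l < N - k) F k l.
Proof.
elim: N => [|N IH]; first by rewrite !big_nil.
rewrite big_nat_recr //= IH [RHS]big_nat_recr //= subSn // subnn big_nat1.
rewrite [X in _ + X]big_nat_recr //= subnn addrA; congr (_ + _).
rewrite -big_split /=; apply: eq_big_nat => k /andP[_ hk].
by rewrite subSn ?(ltnW hk) // [RHS]big_nat_recr.
Qed.

Lemma sum_antidiag_support (V : nmodType) (F : nat -> nat -> V) P Q N :
  (N <= P)%N -> (N <= Q)%N ->
  (forall k l, (k < P)%N -> (l < Q)%N -> (N <= k + l)%N -> F k l = 0) ->
  \sum_(0 <= k < P) \sum_(0 <= l < Q) F k l =
  \sum_(0 <= s < N) \sum_(0 <= k < s.+1) F k (s - k)%N.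
Proof.
move=> hP hQ hF; rewrite sum_antidiag (big_cat_nat (n := N)) //=.
rewrite [X in _ + X]big_nat [X in _ + X]big1 ?addr0 => [|k /andP[hk hk']]; last first.
  rewrite big_nat big1 // => l /andP[_ hl]; apply: hF => //.
  exact: leq_trans hk (leq_addr _ _).
apply: eq_big_nat => k /andP[_ hk].
rewrite (big_cat_nat (n := N - k)) //=; last exact: leq_trans (leq_subr _ _) hQ.
rewrite [X in _ + X]big_nat [X in _ + X]big1 ?addr0 // => l /andP[hl hl'].
by apply: hF => //; [exact: leq_trans hk hP | lia].
Qed.

Lemma sum_even (V : nmodType) (G : nat -> V) k :
  \sum_(0 <= s < k.*2) (if odd s then 0 else G s./2) = \sum_(0 <= j < k) G j.
Proof.
elim: k => [|k IH]; first by rewrite !big_nil.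
by rewrite doubleS !big_nat_recr //= IH odd_double doubleK addr0.
Qed.

End AntidiagonalReindexing.

(** * The two chains of basis vectors *)

Section Chains.
Variables (m n : nat) (hn : (n.*2 <= m)%N).

(** The vectors e_1, .., e_m and f_1, .., f_m of the standard basis are numbered
    from 0 to 2m-1; the chain of index true uses the last n vectors of each half. *)
Definition chain_offset (b : bool) : nat := if b then (m - n)%N else 0%N.
Definition chain_half (b : bool) : nat := if b then n else (m - n)%N.
Definition chain_len (b : bool) : nat := (chain_half b).*2.

(** A chain of length 2p climbs e_1, .., e_p and comes back along f_p, .., f_1. *)
Definition chain_pos (b : bool) (k : nat) : nat :=
  if (k < chain_half b)%N then (chain_offset b + k)%N
  else (m + (chain_offset b + ((chain_len b).-1 - k)))%N.

Section Ring.
Variable A : comNzRingType.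

Definition unit_col (i : nat) : 'cV[A]_(m + m) := \col_j (j == i :> nat)%:R.

(** The signs are those that turn the action of X, which is minus a transposed
    Jordan block on the f_j, into the plain shift b_k -> b_(k-1).  Vectors beyond the
    end of a chain are 0; in particular, for n = 0 all the vectors of the chain of
    index true vanish. *)
Definition chain (b : bool) (k : nat) : 'cV[A]_(m + m) :=
  if (k < chain_len b)%N
  then (-1) ^+ (k - chain_half b) *: unit_col (chain_pos b k) else 0.

Lemma chain_pos_lt b k : (k < chain_len b)%N -> (chain_pos b k < m + m)%N.
Proof.
rewrite /chain_pos /chain_len /chain_offset /chain_half.
by case: b; case: ifP => //; move: hn; lia.
Qed.

Lemma chain_pos_inj b k b' k' :
  (k < chain_len b)%N -> (k' < chain_len b')%N ->
  (chain_pos b k == chain_pos b' k') = (b == b') && (k == k').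
Proof.
rewrite /chain_pos /chain_len /chain_offset /chain_half => h h'.
have -> : (b == b') && (k == k') = (b == b' :> nat) && (k == k').
  by case: b b' {h h'} => [] [].
by move: h h'; case: b; case: b' => /=; case: ifP => //; case: ifP => //;
  move: hn; lia.
Qed.

Lemma chain_pos_onto (i : 'I_(m + m)) :
  exists b k, (k < chain_len b)%N /\ chain_pos b k = i.
Proof.
have hi := ltn_ord i; rewrite /chain_pos /chain_len /chain_half /chain_offset.
have [h1|h1] := ltnP i (m - n).
  by exists false, i; move: hn; rewrite h1; lia.
have [h2|h2] := ltnP i m.
  exists true, (i - (m - n))%N; have -> : (i - (m - n) < n)%N by lia.
  by lia.
have [h3|h3] := ltnP (i - m) (m - n).
  exists false, ((m - n).*2.-1 - (i - m))%N.
  have -> : ((m - n).*2.-1 - (i - m) < m - n)%N = false by lia.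
  by lia.
exists true, (n.*2.-1 - (i - m - (m - n)))%N.
have -> : (n.*2.-1 - (i - m - (m - n)) < n)%N = false by lia.
by lia.
Qed.

Lemma unit_col_orth i j : (i < m + m)%N ->
  (unit_col i)^T *m unit_col j = (i == j)%:R%:M.
Proof.
move=> hi; apply/matrixP => x y; rewrite !ord1 !mxE mulr1n.
rewrite (bigD1 (Ordinal hi)) //= !mxE eqxx mul1r big1 ?addr0 //.
move=> k nk; rewrite !mxE.
have -> : (k == i :> nat) = false by apply/eqP => e; case/eqP: nk; apply/val_inj.
by rewrite mul0r.
Qed.

(** Being a signed permutation of the standard basis, the chains are
    orthonormal for the transpose: row vectors of the chains are the dual basis. *)
Lemma chain_orth b k b' k' :
  (chain b k)^T *m chain b' k' =
  [&& b == b', k == k' & (k < chain_len b)%N]%:R%:M.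
Proof.
rewrite /chain; case: ifP => hk; last first.
  by rewrite trmx0 mul0mx !andbF /= raddf0.
case: ifP => hk'; last first.
  rewrite mulmx0 andbT; case: eqP => [?|_] /=; last by rewrite raddf0.
  case: eqP => [?|_]; last by rewrite raddf0.
  by move: hk hk'; subst => ->.
rewrite [(_ *: _)^T]linearZ /= -scalemxAl -scalemxAr unit_col_orth ?chain_pos_lt //.
rewrite chain_pos_inj // andbT; case: andP => [[/eqP <- /eqP <-]|_].
  by rewrite scalerA -expr2 sqrr_sign scale1r.
by rewrite !scale_scalar_mx !mulr0.
Qed.

Lemma chain_ext p (M N : 'M[A]_(p, m + m)) :
  (forall b k, (k < chain_len b)%N -> M *m chain b k = N *m chain b k) -> M = N.
Proof.
move=> H; apply/matrixP => x i.
have [b [k [hk e]]] := chain_pos_onto i.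
have colE (L : 'M[A]_(p, m + m)) : (L *m unit_col i) x 0 = L x i.
  rewrite !mxE (bigD1 i) //= !mxE eqxx mulr1 big1 ?addr0 // => j nj.
  by rewrite !mxE (_ : (j == i :> nat) = false) ?mulr0 //; apply/negbTE.
have := H b k hk; rewrite /chain hk e -!scalemxAr => /(congr1 (fun L =>
  (-1) ^+ (k - chain_half b) *: L)).
rewrite !scalerA -expr2 sqrr_sign !scale1r => /matrixP/(_ x 0).
by rewrite !colE.
Qed.

Lemma chain_ext2 (M N : 'M[A]_(m + m)) :
  (forall b k b' l, (k < chain_len b)%N -> (l < chain_len b')%N ->
     (chain b k)^T *m M *m chain b' l = (chain b k)^T *m N *m chain b' l) ->
  M = N.
Proof.
move=> H; apply: chain_ext => b' l hl; apply: trmx_inj; apply: chain_ext.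
by move=> b k hk; apply: trmx_inj; rewrite !trmx_mul !trmxK !mulmxA; exact: H.
Qed.

End Ring.

Lemma map_chain (A A' : comNzRingType) (f : {rmorphism A -> A'}) b k :
  map_mx f (chain A b k) = chain A' b k.
Proof.
rewrite /chain; case: ifP => _; last by rewrite map_mx0.
rewrite map_mxZ rmorphXn /= rmorphN1; congr (_ *: _).
by apply/matrixP => i j; rewrite !mxE rmorph_nat.
Qed.

End Chains.

(** * The nilpotent element shifts the chains *)

Section NilpotentAction.
Variables (R : realType) (m n : nat) (hn : (n.*2 <= m)%N).
Local Notation C := R[i].
Local Notation chain := (chain m n C).
Local Notation X := (nilX R hn).

(** Entries of a block diagonal matrix described by one function of the indices
    of the large matrix, which removes the casts from all later computations. *)
Lemma diag_blocksE (A : 'M[C]_(m - n)) (B : 'M[C]_n) (f : nat -> nat -> C) :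
  (forall i j : 'I_(m - n), A i j = f i j) ->
  (forall i j : 'I_n, B i j = f (m - n + i)%N (m - n + j)%N) ->
  forall i j : 'I_m, diag_blocks hn A B i j =
    if (i < m - n)%N == (j < m - n)%N then f i j else 0.
Proof.
move=> hA hB i j; rewrite /diag_blocks castmxE /=.
have e1 := valP (cast_ord (esym (blocks_size hn)) i).
have e2 := valP (cast_ord (esym (blocks_size hn)) j).
rewrite block_mxEh !mxE; case: splitP => [j' ej|j' ej] /=;
  rewrite !mxE; case: splitP => [i' ei|i' ei] /=; rewrite ?mxE /= in ei ej *.
- by rewrite ei ej !ltn_ord /= hA.
- by rewrite ei ej ltn_ord ltnNge leq_addr.
- by rewrite ei ej ltn_ord ltnNge leq_addr.
- by rewrite ei ej !ltnNge !leq_addr /= hB.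
Qed.

Definition jordan_entry (i j : nat) : C := (j == i.+1)%:R.

Definition corner_entry (i j : nat) : C :=
  ((i == j) && ((i.+1 == m - n)%N || (i.+1 == m)))%:R.

Lemma nilX_ul (i j : 'I_m) :
  diag_blocks hn (jordan R (m - n)) (jordan R n) i j =
  if (i < m - n)%N == (j < m - n)%N then jordan_entry i j else 0.
Proof.
apply: diag_blocksE => a b; rewrite !mxE /jordan_entry //.
by rewrite -addnS eqn_add2l.
Qed.

Lemma nilX_ur (i j : 'I_m) :
  diag_blocks hn (munit R (m - n) (m - n) (m - n) (m - n)) (munit R n n n n) i j =
  if (i < m - n)%N == (j < m - n)%N then corner_entry i j else 0.
Proof.
apply: diag_blocksE => a b; rewrite !mxE /corner_entry; congr (_%:R);
  have ha := ltn_ord a; have hb := ltn_ord b; move: hn; lia.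
Qed.

Lemma nilX_block : X = block_mx
  (diag_blocks hn (jordan R (m - n)) (jordan R n))
  (diag_blocks hn (munit R (m - n) (m - n) (m - n) (m - n)) (munit R n n n n)) 0
  (- (diag_blocks hn (jordan R (m - n)) (jordan R n))^T).
Proof.
rewrite /nilX; congr block_mx; apply/matrixP => i j.
rewrite !mxE nilX_ul.
rewrite (@diag_blocksE _ _ (fun i j => - jordan_entry j i)) => [||a b].
- by rewrite eq_sym; case: ifP; rewrite ?oppr0.
- by move=> a b; rewrite !mxE.
- by rewrite !mxE /jordan_entry -addnS eqn_add2l.
Qed.

Definition nilX_entry (i j : nat) : C :=
  if (i < m)%N then
    if (j < m)%N then ((j == i.+1) && (i.+1 != m - n)%N)%:R
    else ((j == m + i)%N && ((i.+1 == m - n)%N || (i.+1 == m)))%:R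
  else if (j < m)%N then 0
  else - ((i == j.+1) && (j.+1 != m + (m - n))%N)%:R.

Lemma nilXE (i j : 'I_(m + m)) : X i j = nilX_entry i j.
Proof.
rewrite nilX_block block_mxEh !mxE /nilX_entry.
case: (splitP j) => [j' ej|j' ej]; rewrite ?mxE; case: (splitP i) => [i' ei|i' ei];
  rewrite ?mxE // ei ej; have hi := ltn_ord i'; have hj := ltn_ord j'.
- rewrite nilX_ul /jordan_entry; case: ifP => h.
    by congr (_%:R); lia.
  by rewrite (_ : _ && _ = false) //; apply/negbTE; lia.
- rewrite nilX_ur /corner_entry; case: ifP => h.
    by congr (_%:R); lia.
  by rewrite (_ : _ && _ = false) //; apply/negbTE; lia.
- rewrite nilX_ul /jordan_entry; case: ifP => h.
    by congr (- (_%:R)); lia.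
  by rewrite (_ : _ && _ = false) ?oppr0 //; apply/negbTE; lia.
Qed.

Lemma mulmx_unit_col (M : 'M[C]_(m + m)) (c : nat) (hc : (c < m + m)%N) i :
  (M *m unit_col m C c) i 0 = M i (Ordinal hc).
Proof.
rewrite !mxE (bigD1 (Ordinal hc)) //= !mxE eqxx mulr1 big1 ?addr0 // => j nj.
rewrite !mxE; have -> : (j == c :> nat) = false; last by rewrite mulr0.
by apply/eqP => e; case/eqP: nj; apply/val_inj.
Qed.

(** X shifts both chains down: e_j -> e_(j-1), f_p -> e_p and f_j -> - f_(j+1). *)
Lemma nilX_chain b k : (k < chain_len m n b)%N ->
  X *m chain b k = if k is l.+1 then chain b l else 0.
Proof.
move=> hk; rewrite /chain hk -scalemxAr.
have hc := chain_pos_lt hn hk.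
apply/matrixP => i j; rewrite !ord1 mxE (mulmx_unit_col _ hc) nilXE /=.
have N0 (x y : bool) : x = false -> y = false -> - x%:R = y%:R :> C.
  by move=> -> ->; rewrite oppr0.
have M0 (s t : C) (x y : bool) : x = false -> y = false -> - (s * x%:R) = t * y%:R.
  by move=> -> ->; rewrite !mulr0 oppr0.
case: i => i hi /=; rewrite /nilX_entry /chain_pos.
case: k hk {hc} => [|l] hk.
  rewrite !mxE sub0n expr0 mul1r.
  case: b hk => /=; rewrite /chain_len /chain_half /chain_offset /= => hk.
    have -> : (0 < n)%N by lia.
    have -> : (m - n + 0 < m)%N by lia.
    by case: ifP => // h1; rewrite (_ : _ && _ = false) //; apply/negbTE; lia.
  have -> : (0 < m - n)%N by lia.
  have -> : (0 + 0 < m)%N by lia.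
  by case: ifP => // h1; rewrite (_ : _ && _ = false) //; apply/negbTE; lia.
rewrite (ltnW hk) !mxE.
have [h|h] := ltnP l.+1 (chain_half m n b).
  rewrite (ltnW h) (_ : l.+1 - _ = 0)%N; last lia.
  rewrite (_ : l - _ = 0)%N; last lia.
  rewrite expr0 !mul1r.
  have -> : (chain_offset m n b + l.+1 < m)%N.
    by move: h hn; rewrite /chain_offset /chain_half; case: b {hk} => /=; lia.
  case: ifP => hi'; last first.
    rewrite (_ : _ == _ = false) //; apply/negbTE.
    by move: h hn; rewrite /chain_offset /chain_half; case: b {hk} => /=; lia.
  by congr (_%:R); move: h hn; rewrite /chain_offset /chain_half; case: b {hk} => /=; lia.
rewrite [(m + _ < m)%N]ltnNge leq_addr /=.
move: h; rewrite leq_eqVlt => /orP[/eqP h|h].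
  rewrite (_ : (l < _)%N); last lia.
  rewrite (_ : l.+1 - _ = 0)%N; last lia.
  rewrite (_ : l - _ = 0)%N; last lia.
  rewrite expr0 !mul1r; case: ifP => hi'.
    by congr (_%:R); move: h hn hk;
     rewrite /chain_offset /chain_len /chain_half; case: b => /=; lia.
  apply: N0; apply/negbTE;
  move: h hn hk; rewrite /chain_offset /chain_len /chain_half; case: b => /=; lia.
have hl := h; rewrite ltnS in hl.
rewrite [(l < _)%N]ltnNge hl /= subSn // {hl} exprS mulN1r mulNr; case: ifP => hi'.
  apply: M0; apply/negbTE;
  move: h hn hk; rewrite /chain_offset /chain_len /chain_half; case: b => /=; lia.
rewrite mulrN opprK; congr (_ * (_%:R));
move: h hn hk; rewrite /chain_offset /chain_len /chain_half; case: b => /=; lia.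
Qed.

End NilpotentAction.

(** * The symplectic form and the values of the form of Y on the chains *)

Section Gram.
Variables (R : realType) (m n : nat) (hn : (n.*2 <= m)%N).
Local Notation C := R[i].
Local Notation chain := (chain m n C).
Local Notation len := (chain_len m n).
Local Notation X := (nilX R hn).
Implicit Types Y Z : 'M[C]_(m + m).

Definition sympl : 'M[C]_(m + m) := block_mx 0 1%:M (- 1%:M) 0.

(** Value of the bilinear form omega(u, Y v) on two chain vectors. *)
Definition gram Y b k b' l : C :=
  ((chain b k)^T *m (sympl *m Y) *m chain b' l) 0 0.

Lemma sympl_sq : sympl *m sympl = - 1%:M.
Proof.
rewrite /sympl mulmx_block !mul0mx !mulmx0 !mul1mx !mulmx1 !add0r !addr0.
by rewrite [in RHS]scalar_mx_block opp_block_mx oppr0.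
Qed.

Lemma scalar11 (M : 'M[C]_1) : M = (M 0 0)%:M.
Proof. by apply/matrixP => i j; rewrite !ord1 !mxE mulr1n. Qed.

Lemma gram_ext Y Z :
  (forall b k b' l, (k < len b)%N -> (l < len b')%N ->
     gram Y b k b' l = gram Z b k b' l) -> Y = Z.
Proof.
move=> H.
suff : sympl *m Y = sympl *m Z.
  move/(congr1 (mulmx sympl)); rewrite !mulmxA sympl_sq !mulNmx !mul1mx.
  exact: oppr_inj.
apply: (chain_ext2 hn) => b k b' l hk hl.
by rewrite [LHS]scalar11 [RHS]scalar11; congr (_%:M); exact: H.
Qed.

Lemma sp_sympl Y : sp Y <-> (sympl *m Y)^T = sympl *m Y.
Proof.
split=> [[P [Q [S [hQ hS ->]]]]|].
  rewrite /sympl mulmx_block !mul0mx !mul1mx !mulNmx !mul1mx !add0r !addr0.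
  by rewrite tr_block_mx !linearN /= trmxK hQ hS.
rewrite -[Y]submxK /sympl mulmx_block !mul0mx !mul1mx !mulNmx !mul1mx !add0r !addr0.
rewrite tr_block_mx !linearN /= => /eq_block_mx[hS hP _ /oppr_inj hQ].
exists (ulsubmx Y), (ursubmx Y), (dlsubmx Y); split => //.
by rewrite -hP.
Qed.

Lemma gram_sym Y b k b' l : sp Y -> gram Y b k b' l = gram Y b' l b k.
Proof.
move=> /sp_sympl h; rewrite /gram -[in RHS]h.
rewrite (_ : _ *m _ *m chain b' l =
  ((chain b' l)^T *m (sympl *m Y)^T *m chain b k)^T); first by rewrite mxE.
by rewrite !trmx_mul !trmxK mulmxA.
Qed.

(** Symmetry on the two chains suffices, because they span. *)
Lemma sp_gram Y :
  (forall b k b' l, (k < len b)%N -> (l < len b')%N ->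
     gram Y b k b' l = gram Y b' l b k) -> sp Y.
Proof.
move=> h; apply/sp_sympl; apply: (chain_ext2 hn) => b k b' l hk hl.
rewrite [LHS]scalar11 [RHS]scalar11; congr (_%:M).
rewrite -/(gram Y b k b' l) h // /gram.
rewrite (_ : _ *m _ *m chain b k =
  ((chain b k)^T *m (sympl *m Y)^T *m chain b' l)^T); first by rewrite [RHS]mxE.
by rewrite !trmx_mul !trmxK mulmxA.
Qed.

Lemma gram_linear (c : C) Y Z b k b' l :
  gram (c *: Y + Z) b k b' l = c * gram Y b k b' l + gram Z b k b' l.
Proof.
by rewrite /gram mulmxDr mulmxDr mulmxDl -!scalemxAr -scalemxAl !mxE.
Qed.

Lemma gramD Y Z b k b' l :
  gram (Y + Z) b k b' l = gram Y b k b' l + gram Z b k b' l.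
Proof. by rewrite -[Y]scale1r gram_linear mul1r scale1r. Qed.

Lemma gramZ (c : C) Y b k b' l : gram (c *: Y) b k b' l = c * gram Y b k b' l.
Proof. by rewrite /gram -!scalemxAr -scalemxAl !mxE. Qed.

(** The chains form a basis and omega is nondegenerate, so the values of the form
    can be prescribed at will. *)
Lemma gram_exists (c : bool -> nat -> bool -> nat -> C) :
  exists Z, forall b k b' l, (k < len b)%N -> (l < len b')%N ->
    gram Z b k b' l = c b k b' l.
Proof.
pose M := \sum_(b : bool) \sum_(k < len b) \sum_(b' : bool) \sum_(l < len b')
  c b k b' l *: (chain b k *m (chain b' l)^T).
exists (- sympl *m M) => b k b' l hk hl.
rewrite /gram mulNmx mulmxN !mulmxA sympl_sq mulNmx opprK mul1mx.
have tri (u v w x : 'cV[C]_(m + m)) :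
    u^T *m (v *m w^T) *m x = (u^T *m v) *m (w^T *m x) by rewrite !mulmxA.
have single (T : finType) (t0 : T) (F : T -> 'M[C]_1) :
    (forall t, t != t0 -> F t = 0) -> \sum_t F t = F t0.
  by move=> hF; rewrite (bigD1 t0) //= big1 ?addr0.
have ordN (N j : nat) (i : 'I_N) (hj : (j < N)%N) :
    i != Ordinal hj -> (i == j :> nat) = false.
  by move=> ni; apply/eqP => e; case/eqP: ni; apply/val_inj.
have E : (chain b k)^T *m M *m chain b' l = (c b k b' l)%:M; last first.
  by rewrite E mxE eqxx mulr1n.
rewrite mulmx_sumr mulmx_suml (single _ b) => [|b1 nb1]; last first.
  rewrite mulmx_sumr mulmx_suml big1 // => k1 _; rewrite mulmx_sumr mulmx_suml.
  rewrite big1 // => b2 _; rewrite mulmx_sumr mulmx_suml big1 // => l1 _.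
  rewrite -scalemxAr -scalemxAl tri chain_orth // eq_sym (negbTE nb1) /=.
  by rewrite raddf0 mul0mx scaler0.
rewrite mulmx_sumr mulmx_suml (single _ (Ordinal hk)) => [|k1 nk1]; last first.
  rewrite mulmx_sumr mulmx_suml.
  rewrite big1 // => b2 _; rewrite mulmx_sumr mulmx_suml big1 // => l1 _.
  rewrite -scalemxAr -scalemxAl tri chain_orth // [k == _]eq_sym ordN //.
  by rewrite andbF /= raddf0 mul0mx scaler0.
rewrite mulmx_sumr mulmx_suml (single _ b') => [|b1 nb1]; last first.
  rewrite mulmx_sumr mulmx_suml big1 // => l1 _.
  rewrite -scalemxAr -scalemxAl tri [_^T *m chain b' l]chain_orth // (negbTE nb1) /=.
  by rewrite raddf0 mulmx0 scaler0.
rewrite mulmx_sumr mulmx_suml (single _ (Ordinal hl)) => [|l1 nl1]; last first.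
  rewrite -scalemxAr -scalemxAl tri [_^T *m chain b' l]chain_orth // ordN // andbF /=.
  by rewrite raddf0 mulmx0 scaler0.
rewrite -scalemxAr -scalemxAl tri !chain_orth // !eqxx hk hl /=.
by rewrite mul1mx scalemx1.
Qed.

Lemma sp_nilX : sp X.
Proof.
rewrite nilX_block; do 3!eexists; split; last reflexivity; rewrite ?trmx0 //.
apply/matrixP => i j; rewrite mxE !nilX_ur eq_sym /corner_entry.
by case: ifP => // _; rewrite eq_sym; case: eqP => [->|].
Qed.

Lemma sympl_nilX : sympl *m X = - (X^T *m sympl).
Proof.
have := sp_nilX; move=> /sp_sympl => h; rewrite -[LHS]h trmx_mul -mulmxN; congr (_ *m _).
rewrite /sympl tr_block_mx !trmx0 [(- _)^T]linearN /= trmx1.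
by rewrite opp_block_mx opprK oppr0.
Qed.

(** X is skew for omega, so the form of [Z, X] at (u, v) is that of Z at (u, X v)
    plus that of Z at (X u, v), and X shifts the chains. *)
Lemma gram_bracket Z b k b' l : (k < len b)%N -> (l < len b')%N ->
  gram (Z *m X - X *m Z) b k b' l =
    (if l is l1.+1 then gram Z b k b' l1 else 0)
    + (if k is k1.+1 then gram Z b k1 b' l else 0).
Proof.
move=> hk hl; rewrite /gram mulmxBr [sympl *m (X *m Z)]mulmxA sympl_nilX.
rewrite mulNmx opprK mulmxDr mulmxDl mxE; congr (_ + _).
  rewrite -!mulmxA nilX_chain //; case: l hl => [|l] hl.
    by rewrite !mulmx0 mxE.
  by rewrite /gram !mulmxA.
rewrite !mulmxA -trmx_mul nilX_chain //; case: k hk => [|k] hk.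
  by rewrite trmx0 !mul0mx mxE.
by rewrite /gram !mulmxA.
Qed.

Lemma sp_linear (c : C) Y Z : sp Y -> sp Z -> sp (c *: Y + Z).
Proof.
move=> hY hZ; apply: sp_gram => b k b' l _ _; rewrite !gram_linear.
by rewrite (gram_sym b k b' l hY) (gram_sym b k b' l hZ).
Qed.

Lemma sp0 : sp (0 : 'M[C]_(m + m)).
Proof.
by apply: sp_gram => b k b' l _ _; rewrite /gram mulmx0 !mulmx0 !mul0mx !mxE.
Qed.

Lemma sp_bracket Z : sp Z -> sp (Z *m X - X *m Z).
Proof.
move=> hZ; apply: sp_gram => b k b' l hk hl; rewrite !gram_bracket // addrC.
by congr (_ + _); [case: k {hk} | case: l {hl}] => // ?; exact: gram_sym.
Qed.

(** omega pairs the vector k of a chain of length 2p with the vector 2p-1-k of the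
    same chain only; it converts gram Y into matrix coefficients of Y. *)
Lemma chain_sympl b k : (k < len b)%N ->
  (chain b k)^T *m sympl =
  (-1) ^+ (chain_half m n b + k).+1 *: (chain b ((len b).-1 - k))^T.
Proof.
have ul (i : nat) : (i < m)%N -> (unit_col m C i)^T *m sympl = (unit_col m C (m + i))^T.
  move=> hi; apply/matrixP => x j; rewrite !ord1 !mxE.
  rewrite (bigD1 (lshift m (Ordinal hi))) //= big1 ?addr0; last first.
    move=> j' nj; rewrite !mxE (_ : (j' == i :> nat) = false) ?mul0r //.
    by apply/eqP => e; case/eqP: nj; apply/val_inj.
  rewrite !mxE eqxx mul1r; case: (splitP (lshift m (Ordinal hi))) => j1 /= e1; last first.
    by move: hi; rewrite e1 ltnNge leq_addr.
  rewrite mxE; case: (splitP j) => j2 /= e2; rewrite mxE e2.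
    by rewrite (_ : _ == _ = false) //; apply/negbTE; have := ltn_ord j2; lia.
  by congr (_%:R); rewrite eqn_add2l e1 eq_sym.
have ur (i : nat) : (i < m)%N ->
    (unit_col m C (m + i))^T *m sympl = - (unit_col m C i)^T.
  move=> hi; rewrite -ul // -mulmxA sympl_sq mulmxN mulmx1 //.
move=> hk; rewrite /chain hk.
have hk' : ((len b).-1 - k < len b)%N by lia.
rewrite hk' ![(_ *: _)^T]linearZ /= -scalemxAl scalerA /chain_pos.
have [h|h] := ltnP k (chain_half m n b).
  rewrite ifF; last by apply/negbTE; move: h; rewrite /chain_len; lia.
  rewrite ul; last first.
    by move: h hn; rewrite /chain_half /chain_offset; case: b {hk hk'} => /=; lia.
  congr (_ *: (unit_col _ _ _)^T); last first.
    by move: h; rewrite /chain_len; lia.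
  rewrite (_ : (k - _ = 0)%N); last lia.
  rewrite -exprD -signr_odd; apply/esym; rewrite -signr_odd; congr (_ ^+ _).
  by move: h; rewrite /chain_len; lia.
rewrite ifT; last by move: h hk; rewrite /chain_len; lia.
rewrite ur; last first.
  by move: h hk hn; rewrite /chain_len /chain_half /chain_offset;
     case: b {hk'} => /=; lia.
rewrite scalerN -scaleNr; congr (_ *: _).
rewrite (_ : (_ - k - _ = 0)%N); last by move: h hk; rewrite /chain_len; lia.
rewrite expr0 mulr1 -mulN1r -exprS -signr_odd; apply/esym; rewrite -signr_odd.
by congr (_ ^+ _); move: h hk; rewrite /chain_len; lia.
Qed.

End Gram.

(** * Directions of the slice *)

Section SliceDirections.
Variables (R : realType) (m n : nat) (hn : (n.*2 <= m)%N).
Local Notation C := R[i].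
Local Notation chain := (chain m n C).
Local Notation len := (chain_len m n).
Local Notation X := (nilX R hn).
Local Notation gram := (gram n).
Implicit Types (a y z d : nat -> C).

Definition lower_block (M : 'M[C]_m) : 'M[C]_(m + m) := block_mx 0 0 M 0.

(** The tangent direction of z_n when m = 2n, written with chain vectors:
    the matrix E_(m,n) - E_(n+m,2m). *)
Definition cross_mx : 'M[C]_(m + m) :=
  chain true n.-1 *m (chain false (m - n).-1)^T
  - chain false (m - n) *m (chain true n)^T.

(** When m = 2n the coordinate z_n leaves the symmetric block of the slice and becomes
    the coefficient z_cross of cross_mx. *)
Definition z_top : nat := if n.*2 == m then n.-1 else n.
Definition z_cross z : C := if n.*2 == m then z n else 0.

Definition slice_dir a y z d : 'M[C]_(m + m) :=
  lower_block (slice_block m n z_top a y z d) + z_cross z *: cross_mx.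

(** The term z_n^2 only reparametrizes the coordinate d_1, so the slice is the
    affine space through X with the linear directions slice_dir. *)
Lemma slice_mx_dir a y z d : slice_mx hn a y z d =
  X + slice_dir a y z
    (fun j => if (n.*2 == m) && (j == 1%N) then d 1%N - z n ^+ 2 else d j).
Proof.
rewrite /slice_mx /slice_dir /z_top /z_cross; case: eqP => e /=; last first.
  by rewrite scale0r addr0.
rewrite addrA; congr (_ + _ *: _).
have [n0|n0] := posnP n.
  by apply/matrixP => -[i hi]; exfalso; lia.
rewrite /cross_mx /chain /chain_len /chain_half /chain_pos /chain_offset /chain_half.
have -> : (n.-1 < n.*2)%N by lia.
have -> : ((m - n).-1 < (m - n).*2)%N by lia.
have -> : ((m - n) < (m - n).*2)%N by lia.
have -> : (n < n.*2)%N by lia.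
have -> : (n.-1 < n)%N by lia.
have -> : ((m - n).-1 < m - n)%N by lia.
rewrite !ltnn !subnn !expr0 !scale1r.
rewrite (_ : (n.-1 - n = 0)%N); last lia.
rewrite (_ : ((m - n).-1 - (m - n) = 0)%N); last lia.
rewrite !expr0 !scale1r; congr (_ - _); apply/matrixP => i j;
 rewrite !mxE big_ord1 !mxE -natrM mulnb; congr (_%:R); move: i j => [i hi] [j hj] /=;
 congr (nat_of_bool (_ && _)); rewrite ?/chain_len /=; lia.
Qed.

(** Form of a slice direction on the vector k of the long chain and the vector l of
    the short one.  The y_i fill the row k = 0 and the z_i continue along the column
    l = n-1; when m = 2n this column meets the f_j at k = n, and z_n is moved, with a sign,
    one step up its antidiagonal to (n-1, n). *)
Definition cross_coef y z (k l : nat) : C :=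
  (if (k == 0)%N && (l < n)%N then y l.+1
   else if (l.+1 == n)%N && (0 < k <= z_top)%N then z k else 0)
  - (if (k.+1 == m - n)%N && (l == n) then z_cross z else 0).

Definition slice_coef a y z d b (k : nat) b' (l : nat) : C :=
  match b, b' with
  | false, false => if (k == l) && (k < m - n)%N then d (m - n - k)%N else 0
  | true, true => if (k == l) && (k < n)%N then a (n - k)%N else 0
  | false, true => cross_coef y z k l
  | true, false => cross_coef y z l k
  end.

Lemma dsubmx_chain b k : (k < chain_half m n b)%N -> dsubmx (chain b k) = 0.
Proof.
move=> h; rewrite /chain /chain_pos h; case: ifP => _; last by rewrite linear0.
apply/matrixP => i j; rewrite !mxE (_ : _ == _ = false) ?mulr0 //=; apply/negbTE.
by move: h hn; rewrite /chain_half /chain_offset; case: b => /=; lia.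
Qed.

Lemma usubmx_chain b k : (chain_half m n b <= k)%N -> usubmx (chain b k) = 0.
Proof.
move=> h; rewrite /chain /chain_pos (_ : (k < chain_half m n b)%N = false); last first.
  by apply/negbTE; rewrite -leqNgt.
case: ifP => _; last by rewrite linear0.
apply/matrixP => i j; rewrite !mxE (_ : _ == _ = false) ?mulr0 //=; apply/negbTE.
by have := ltn_ord i; lia.
Qed.

Lemma lower_block_chain (M : 'M[C]_m) b k :
  (chain_half m n b <= k)%N -> lower_block M *m chain b k = 0.
Proof.
move=> h; rewrite -[chain b k]vsubmxK usubmx_chain // mul_block_col.
by rewrite !mul0mx !mulmx0 !addr0 col_mx0.
Qed.

Lemma chain_lower_block (M : 'M[C]_m) b k :
  (k < chain_half m n b)%N -> (chain b k)^T *m lower_block M = 0.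
Proof.
move=> h; rewrite -[chain b k]vsubmxK dsubmx_chain // tr_col_mx trmx0.
by rewrite mul_row_block !mul0mx !mulmx0 !addr0 row_mx0.
Qed.

Lemma gram_lower_block (f : nat -> nat -> C) (M : 'M[C]_m) b k b' l :
  (forall i j : 'I_m, M i j = f i j) ->
  (k < len b)%N -> (l < len b')%N ->
  gram (lower_block M) b k b' l =
    if (k < chain_half m n b)%N && (l < chain_half m n b')%N
    then f (chain_offset m n b + k)%N (chain_offset m n b' + l)%N else 0.
Proof.
move=> hM hk hl; rewrite /gram /lower_block /sympl mulmx_block.
rewrite !mul0mx !mulmx0 mul1mx !add0r.
have unitE c j : (j < len c)%N -> (j < chain_half m n c)%N ->
    usubmx (chain c j) = \col_i (i == chain_offset m n c + j :> nat)%N%:R.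
  move=> hj h; apply/matrixP => x x'; rewrite /chain hj /chain_pos h !mxE /=.
  by rewrite (_ : (j - _ = 0)%N) ?expr0 ?mul1r //; lia.
rewrite -[chain b k]vsubmxK -[chain b' l]vsubmxK.
have [h|h] := ltnP k (chain_half m n b); last first.
  rewrite usubmx_chain // tr_col_mx trmx0 mul_row_block !mul0mx !mulmx0 !addr0.
  by rewrite row_mx0 mul0mx mxE.
have [h'|h'] := ltnP l (chain_half m n b'); last first.
  rewrite [usubmx (chain b' l)]usubmx_chain // tr_col_mx mul_row_block !mulmx0 !addr0.
  by rewrite mul_row_col mulmx0 mul0mx addr0 mxE.
rewrite [dsubmx (chain b k)]dsubmx_chain // [dsubmx (chain b' l)]dsubmx_chain // !unitE //.
rewrite tr_col_mx mul_row_block !mulmx0 !addr0 mul_row_col mulmx0 addr0.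
have hi : (chain_offset m n b + k < m)%N.
  by move: h hn; rewrite /chain_half /chain_offset; case: b {hk}; lia.
have hj : (chain_offset m n b' + l < m)%N.
  by move: h' hn; rewrite /chain_half /chain_offset; case: b' {hl}; lia.
rewrite -(hM (Ordinal hi) (Ordinal hj)).
rewrite mxE (bigD1 (Ordinal hj)) //= big1 ?addr0 => [|j' nj]; last first.
  rewrite !mxE (_ : _ == _ = false) ?mulr0 //.
  by apply/eqP => e; case/eqP: nj; apply/val_inj.
rewrite !mxE eqxx mulr1 (bigD1 (Ordinal hi)) //= big1 ?addr0 => [|j' nj]; last first.
  rewrite !mxE (_ : _ == _ = false) ?mul0r //.
  by apply/eqP => e; case/eqP: nj; apply/val_inj.
by rewrite !mxE eqxx mul1r.
Qed.

Lemma gram_cross b k b' l : (k < len b)%N -> (l < len b')%N ->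
  gram cross_mx b k b' l =
  match b, b' with
  | false, true => - ((k.+1 == m - n)%N && (l == n))%:R
  | true, false => - ((l.+1 == m - n)%N && (k == n))%:R
  | _, _ => 0 end.
Proof.
move=> hk hl; rewrite /gram mulmxA chain_sympl // /cross_mx.
have tri (u v w x : 'cV[C]_(m + m)) :
    u^T *m (v *m w^T) *m x = (u^T *m v) *m (w^T *m x) by rewrite !mulmxA.
rewrite -scalemxAl mulmxBr -scalemxAl mulmxBl !tri !(chain_orth hn).
rewrite -scalar_mxM -scalar_mxM -raddfB scale_scalar_mx mxE eqxx mulr1n.
move: hk hl; rewrite /chain_len /chain_half.
case: b; case: b' => /= hk hl; rewrite ?mul0r ?mulr0 ?subr0 ?subrr ?mulr0 //.
- rewrite -natrM mulnb; case: (altP (k =P n)) => [e|ne].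
    rewrite e addnn -signr_odd /= odd_double expr1 mulN1r.
    by congr (- (nat_of_bool _)%:R); lia.
  by rewrite (_ : _ && _ = false) ?andbF ?mulr0 ?oppr0 //; lia.
- rewrite sub0r -natrM mulnb; case: (altP (k.+1 =P (m - n)%N)) => [e|ne].
    rewrite -addnS e addnn -signr_odd odd_double expr0 mul1r.
    by congr (- (nat_of_bool _)%:R); lia.
  by rewrite (_ : _ && _ = false) ?oppr0 ?mulr0 ?oppr0 //; lia.
Qed.

Lemma gram_slice_dir a y z d b k b' l : (k < len b)%N -> (l < len b')%N ->
  gram (slice_dir a y z d) b k b' l = slice_coef a y z d b k b' l.
Proof.
move=> hk hl; rewrite gramD gramZ gram_cross //.
pose f i j :=  let p := (minn i j).+1 in
    let q := (maxn i j).+1 in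
    if p == q then
      (if (p <= m - n)%N then d (m - n + 1 - p)%N else a (m + 1 - p)%N)
    else if (p == 1%N) && (m - n < q)%N then y (q - (m - n))%N
    else if (q == m) && (1 < p <= z_top.+1)%N then z p.-1
    else 0.
rewrite (gram_lower_block (f := f)) //; last by move=> i j; rewrite mxE.
move: hk hl; rewrite /slice_coef /cross_coef /f /chain_len /chain_half /chain_offset.
have zt : (z_top <= n)%N by rewrite /z_top; case: ifP; lia.
have zm : (z_top < m - n)%N || (n == 0)%N by rewrite /z_top; case: ifP; move: hn; lia.
case: b; case: b' => hk hl.
- rewrite mulr0 addr0 eqSS.
  case: (altP (k =P l)) => [<-|nkl] /=.
    rewrite andbb minnn maxnn eqxx; case: ifP => // h.
    by rewrite ifF; [congr a|]; move: hn; lia.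
  by case: ifP => // h; rewrite !ifF //; move: hn; lia.
- case: (boolP (k < n)%N) => hk' /=; last first.
    rewrite add0r (_ : (l == 0)%N && _ = false); last lia.
    rewrite (_ : (k.+1 == n) && _ = false); last lia.
    by rewrite sub0r mulrN; case: (_ && _); rewrite ?mulr1 ?mulr0.
  have -> : (k == n) = false by lia.
  rewrite andbF mulrN mulr0 subr0 oppr0 addr0.
  have -> : (maxn (m - n + k) (0 + l)).+1 =
      if (l < m - n + k)%N then (m - n + k).+1 else l.+1
    by case: ltnP; lia.
  have -> : (minn (m - n + k) (0 + l)).+1 =
      if (l < m - n + k)%N then l.+1 else (m - n + k).+1
    by case: ltnP; lia.
  case: (boolP (l < m - n)%N) => hl'; last first.
    by rewrite !ifF //; move: hn; lia.
  rewrite ltn_addr // ifF; last lia.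
  rewrite eqSS (_ : (m - n < (m - n + k).+1)%N); last lia.
  have -> : ((m - n + k).+1 - (m - n) = k.+1)%N by clear -hk; lia.
  have -> : (minn (m - n + k) (0 + l)) = l by lia.
  rewrite /= ?andbT; case: ifP => h //.
  by congr (if _ then _ else _); move: hn; lia.
- case: (boolP (l < n)%N) => hk' /=; last first.
    rewrite andbF add0r (_ : (k == 0)%N && _ = false); last lia.
    rewrite (_ : (l.+1 == n) && _ = false); last lia.
    by rewrite sub0r mulrN; case: (_ && _); rewrite ?mulr1 ?mulr0.
  have -> : (l == n) = false by lia.
  rewrite !andbF !andbT mulrN mulr0 subr0 oppr0 addr0.
  have -> : (maxn (0 + k) (m - n + l)).+1 =
      if (k < m - n + l)%N then (m - n + l).+1 else k.+1
    by case: ltnP; lia.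
  have -> : (minn (0 + k) (m - n + l)).+1 =
      if (k < m - n + l)%N then k.+1 else (m - n + l).+1
    by case: ltnP; lia.
  case: (boolP (k < m - n)%N) => hl'; last first.
    by rewrite !ifF //; move: hn; lia.
  rewrite ltn_addr // ifF; last lia.
  rewrite eqSS (_ : (m - n < (m - n + l).+1)%N); last lia.
  have -> : ((m - n + l).+1 - (m - n) = l.+1)%N by clear -hk; lia.
  have -> : (minn (0 + k) (m - n + l)) = k by lia.
  rewrite /= ?andbT; case: ifP => h //.
  by congr (if _ then _ else _); move: hn; lia.
- rewrite mulr0 addr0 !add0n eqSS.
  case: (altP (k =P l)) => [<-|nkl] /=.
    rewrite andbb minnn maxnn eqxx; case: ifP => // h.
    by rewrite h; congr d; lia.
  by case: ifP => // h; rewrite !ifF //; move: hn; lia.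
Qed.

End SliceDirections.

(** * Solving the bracket equation along antidiagonals *)

Section AntidiagonalSums.
Variable C : numFieldType.

Lemma big_ord_single (N k0 : nat) (F : nat -> C) :
  (k0 < N)%N -> (forall k, (k < N)%N -> k != k0 -> F k = 0) ->
  \sum_(k < N) F k = F k0.
Proof.
move=> hk hF; rewrite (bigD1 (Ordinal hk)) //= big1 ?addr0 // => k nk.
by apply: hF => //; apply: contraNneq nk => e; apply/eqP/val_inj.
Qed.

(** The equations with l > 0 determine g row by row, and those with l = 0 then say
    that the alternating sum of c over the antidiagonal k vanishes, for every row k < P.
    So the first index must run over the shorter side of a block. *)
Lemma antidiag_solve (P : nat) (c : nat -> nat -> C) :
  (forall s, (s < P)%N -> \sum_(k < s.+1) (-1) ^+ k * c k (s - k)%N = 0) ->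
  exists g : nat -> nat -> C, forall k l, (k < P)%N ->
    (if l is l1.+1 then g k l1 else 0) + (if k is k1.+1 then g k1 l else 0) = c k l.
Proof.
move=> H.
(* The recursion g (k, l) = c (k, l+1) - g (k-1, l+1), unrolled. *)
pose g k l := \sum_(j < k.+1) (-1) ^+ (k - j) * c j (l.+1 + (k - j))%N.
have gS k l : g k.+1 l + g k l.+1 = c k.+1 l.+1.
  rewrite /g big_ord_recr /= subnn expr0 mul1r addn0 addrAC -big_split /=.
  rewrite big1 ?add0r // => j _; have hj := ltn_ord j.
  rewrite subSn // exprS mulN1r mulNr addnS addSn; exact: addNr.
exists g => k l hk; case: l k hk => [|l] [|k] hk.
- by rewrite add0r; have := H 0%N hk; rewrite big_ord1 expr0 mul1r subnn => ->.
- rewrite add0r; have := H k.+1 hk.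
  rewrite big_ord_recr /= subnn => /(congr1 (fun x => (-1) ^+ k.+1 * x)).
  rewrite mulr0 mulrDr mulrA -expr2 sqrr_sign mul1r => /eqP.
  rewrite addrC addr_eq0 => /eqP ->.
  rewrite mulr_sumr -sumrN; apply: eq_bigr => j _; have hj := ltn_ord j.
  rewrite add1n subSn // mulrA -exprD -mulNr; congr (_ * _).
  rewrite addSn exprS mulN1r opprK -signr_odd; apply/esym; rewrite -signr_odd.
  by congr (_ ^+ _); lia.
- by rewrite addr0 /g big_ord1 subnn expr0 mul1r addn0.
- exact: gS.
Qed.

End AntidiagonalSums.

(** * The slice directions complement the image of the adjoint map *)

Section Transversality.
Variables (R : realType) (m n : nat) (hn : (n.*2 <= m)%N).
Local Notation C := R[i].
Local Notation chain := (chain m n C).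
Local Notation len := (chain_len m n).
Local Notation X := (nilX R hn).
Local Notation gram := (gram n).
Implicit Types (a y z d : nat -> C) (Y Z : 'M[C]_(m + m)).

(** For s less than both sides of a block, these functionals span the annihilator of
    the image of the bracket with X. *)
Definition antidiag Y b b' s : C := \sum_(k < s.+1) (-1) ^+ k * gram Y b k b' (s - k).

Lemma antidiag_linear (c : C) Y Z b b' s :
  antidiag (c *: Y + Z) b b' s = c * antidiag Y b b' s + antidiag Z b b' s.
Proof.
rewrite /antidiag mulr_sumr -big_split /=; apply: eq_bigr => k _.
by rewrite gram_linear mulrDr mulrCA.
Qed.

(** The two terms of gram_bracket telescope along an antidiagonal shorter than both
    sides of the block. *)
Lemma antidiag_bracket Z b b' s : (s < len b)%N -> (s < len b')%N ->
  antidiag (Z *m X - X *m Z) b b' s = 0.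
Proof.
move=> hb hb'.
rewrite /antidiag (eq_bigr (fun k : 'I_s.+1 =>
   (-1) ^+ k * (if (s - k)%N is l.+1 then gram Z b k b' l else 0)
   + (-1) ^+ k * (if (k : nat) is k1.+1 then gram Z b k1 b' (s - k) else 0)));
  last first.
  by move=> k _; have := ltn_ord k => hk; rewrite gram_bracket ?mulrDr //; lia.
rewrite big_split /= big_ord_recr /= subnn mulr0 addr0.
rewrite [X in _ + X]big_ord_recl /= mulr0 add0r -big_split /= big1 // => k _.
have hk := ltn_ord k; rewrite (_ : (s - k = (s - k.+1).+1)%N); last lia.
by rewrite /bump /= add1n exprS mulN1r mulNr subrr.
Qed.

(** The even antidiagonal 2k of a diagonal block contains the coordinate of index
    p-k at its centre (k, k), and no other. *)
Lemma antidiag_dir_diag a y z d b s : (s < len b)%N ->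
  antidiag (slice_dir m n a y z d) b b s =
  if odd s then 0
  else (-1) ^+ s./2 * (if b then a else d) (chain_half m n b - s./2)%N.
Proof.
move=> hs; rewrite /antidiag.
rewrite (eq_bigr (fun k : 'I_s.+1 =>
  (-1) ^+ k * slice_coef m n a y z d b k b (s - k))) => [|k _]; last first.
  by have := ltn_ord k => hk; rewrite gram_slice_dir //; lia.
have coefE k : slice_coef m n a y z d b k b (s - k) =
    if (k == s - k)%N && (k < chain_half m n b)%N
    then (if b then a else d) (chain_half m n b - k)%N else 0.
  by case: b {hs}.
case: ifP => os.
  rewrite big1 // => k _; rewrite coefE ifF ?mulr0 //.
  by have := ltn_ord k; lia.
rewrite (@big_ord_single _ _ s./2 (fun k =>
   (-1) ^+ k * slice_coef m n a y z d b k b (s - k))) => [||k hk nk].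
- by rewrite coefE ifT //; move: hs; rewrite /chain_len; lia.
- lia.
- by rewrite coefE ifF ?mulr0 //; lia.
Qed.

(** Along the row and the column carrying the y_i and the z_i each antidiagonal
    is met once; moving z_n to its neighbour when m = 2n does not change the alternating sum. *)
Lemma antidiag_dir_cross a y z d s : (s < n.*2)%N ->
  antidiag (slice_dir m n a y z d) true false s =
  if (s < n)%N then (-1) ^+ s * y s.+1 else (-1) ^+ n.-1 * z (s - n).+1.
Proof.
move=> hs; rewrite /antidiag.
rewrite (eq_bigr (fun k : 'I_s.+1 =>
  (-1) ^+ k * cross_coef m n y z (s - k) k)) => [|k _]; last first.
  have := ltn_ord k => hk; rewrite gram_slice_dir //; rewrite /chain_len /=; first lia.
  by move: hn; lia.
pose F k := (-1) ^+ k * cross_coef m n y z (s - k) k.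
rewrite (_ : \sum_(k < s.+1) _ = \sum_(k < s.+1) F k) //.
have zt : (z_top m n <= n)%N by rewrite /z_top; case: ifP; lia.
case: ifP => sn.
  rewrite (@big_ord_single _ _ s F) /F /cross_coef => [||k hk nk]; last first.
  - rewrite ifF; last lia.
    rewrite ifF; last lia.
    by rewrite ifF ?subr0 ?mulr0 //; lia.
  - lia.
  by rewrite subnn eqxx sn /= ifF ?subr0 //; lia.
have [/andP[/eqP e /eqP es]|ne] := boolP ((n.*2 == m) && (s.+1 == n.*2)).
  have zt' : z_top m n = n.-1 by rewrite /z_top e eqxx.
  rewrite (@big_ord_single _ _ n F) /F /cross_coef => [||k hk nk]; last first.
  - rewrite ifF; last lia.
    rewrite ifF; last lia.
    by rewrite ifF ?subr0 ?mulr0 //; lia.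
  - lia.
  rewrite ifF; last lia.
  rewrite ifF; last lia.
  rewrite ifT; last lia.
  have n0 : (0 < n)%N by lia.
  rewrite /z_cross e eqxx sub0r -[in X in X * _](prednK n0) exprS mulN1r mulrNN.
  by congr (_ * z _); lia.
have zt' : (s - n < z_top m n)%N.
  by move: ne; rewrite /z_top; case: ifP => /= h; lia.
have zc k : (if (s - k).+1 == (m - n)%N then if k == n then z_cross m n z else 0 else 0) = 0.
  case: ifP => // h1; case: ifP => // h2; rewrite /z_cross; case: ifP => // h3.
  by move: ne; rewrite h3 /=; lia.
have zcE k : (if ((s - k).+1 == (m - n)%N) && (k == n) then z_cross m n z else 0) = 0.
  by rewrite -[RHS](zc k); case: (_ == (m - n)%N).
rewrite (@big_ord_single _ _ n.-1 F) /F /cross_coef => [||k hk nk]; last first.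
- rewrite zcE subr0 ifF; last lia.
  by rewrite ifF ?mulr0 //; lia.
- lia.
rewrite zcE subr0 ifF; last lia.
rewrite ifT; last lia.
by congr (_ * z _); lia.
Qed.

Lemma antidiag_swap Y b b' s : sp Y ->
  antidiag Y b b' s = (-1) ^+ s * antidiag Y b' b s.
Proof.
move=> hY; rewrite /antidiag (reindex_inj rev_ord_inj) /= mulr_sumr.
apply: eq_bigr => k _; have hk : (k <= s)%N by rewrite -ltnS.
rewrite subSS (gram_sym _ _ _ _ _ hY) subKn // mulrA; congr (_ * _).
by rewrite -exprD -signr_odd oddB // -[RHS]signr_odd oddD.
Qed.

(** In a symmetric block the terms of an odd antidiagonal cancel in pairs. *)
Lemma antidiag_sym Y b s : sp Y -> odd s -> antidiag Y b b s = 0.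
Proof.
move=> hY os; suff /eqP : antidiag Y b b s + antidiag Y b b s = 0.
  by rewrite -mulr2n mulrn_eq0 => /eqP.
by rewrite {1}antidiag_swap // -signr_odd os expr1 mulN1r addNr.
Qed.

(** The equation is solved in each block; the block of index (true, false) has its
    shorter side first, its solution is transposed into the other mixed block, and the
    solutions of the diagonal blocks are symmetrized so that Z stays in sp. *)
Lemma bracket_of_antidiag0 Y : sp Y ->
  (forall b s, (s < len b)%N -> antidiag Y b b s = 0) ->
  (forall s, (s < n.*2)%N -> antidiag Y true false s = 0) ->
  exists2 Z, sp Z & Z *m X - X *m Z = Y.
Proof.
move=> hY hd hc.
have [gt hgt] := antidiag_solve (c := fun k l => gram Y true k true l) (hd true).
have [gf hgf] := antidiag_solve (c := fun k l => gram Y false k false l) (hd false).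
have [gc hgc] := antidiag_solve (c := fun k l => gram Y true k false l) hc.
have [Z hZ] := gram_exists hn (fun b k b' l => match b, b' with
  | true, true => 2^-1 * (gt k l + gt l k)
  | false, false => 2^-1 * (gf k l + gf l k)
  | true, false => gc k l
  | false, true => gc l k end).
exists Z.
  apply: (sp_gram hn) => b k b' l hk hl; rewrite !hZ //.
  by case: b {hk}; case: b' {hl} => //; rewrite addrC.
apply: (gram_ext hn) => b k b' l hk hl; rewrite gram_bracket //.
have hl1 l1 : l = l1.+1 -> (l1 < len b')%N by move: hl; lia.
have hk1 k1 : k = k1.+1 -> (k1 < len b)%N by move: hk; lia.
have half2 (x : C) : 2^-1 * (x + x) = x.
  by rewrite -mulr2n -[x *+ 2]mulr_natl mulKf // pnatr_eq0.
have -> : (if l is l1.+1 then gram Z b k b' l1 else 0) =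
   (if l is l1.+1 then match b, b' with
  | true, true => 2^-1 * (gt k l1 + gt l1 k)
  | false, false => 2^-1 * (gf k l1 + gf l1 k)
  | true, false => gc k l1
  | false, true => gc l1 k end else 0).
  by case: l hl1 {hl} => // l hl1; rewrite hZ // hl1.
have -> : (if k is k1.+1 then gram Z b k1 b' l else 0) =
   (if k is k1.+1 then match b, b' with
  | true, true => 2^-1 * (gt k1 l + gt l k1)
  | false, false => 2^-1 * (gf k1 l + gf l k1)
  | true, false => gc k1 l
  | false, true => gc l k1 end else 0).
  by case: k hk1 {hk} => // k hk1; rewrite hZ // hk1.
have sum_diag (g : nat -> nat -> C) :
   (forall k l, (k < len b)%N ->
     (if l is l1.+1 then g k l1 else 0) + (if k is k1.+1 then g k1 l else 0)
     = gram Y b k b l) -> b = b' ->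
   (if l is l1.+1 then 2^-1 * (g k l1 + g l1 k) else 0)
   + (if k is k1.+1 then 2^-1 * (g k1 l + g l k1) else 0) = gram Y b k b' l.
  move=> hg e; subst b'; rewrite -[RHS]half2 {2}(gram_sym n b k b l hY) -!hg //.
  case: l {hl hl1} => [|l]; case: k {hk hk1} => [|k]; rewrite ?add0r ?addr0 ?mulr0 //.
  by rewrite -mulrDr addrACA [g l k.+1 + _]addrC.
case: b b' hk hl {hl1 hk1} sum_diag => [] [] hk hl sum_diag.
- exact: sum_diag.
- exact: hgc.
- by rewrite (gram_sym _ _ _ _ _ hY) -hgc // addrC.
- exact: sum_diag.
Qed.

(** Each coordinate of a slice direction is, up to sign, one of its antidiagonal
    sums. *)
Lemma slice_dir_eq0 a y z d :
  (forall b s, (s < len b)%N -> antidiag (slice_dir m n a y z d) b b s = 0) ->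
  (forall s, (s < n.*2)%N -> antidiag (slice_dir m n a y z d) true false s = 0) ->
  slice_dir m n a y z d = 0.
Proof.
move=> hd hc.
have diag0 b k : (k < chain_half m n b)%N ->
    (if b then a else d) (chain_half m n b - k)%N = 0.
  move=> hk; have hs : (k.*2 < len b)%N by rewrite /chain_len ltn_double.
  have := antidiag_dir_diag a y z d hs; rewrite hd //.
  rewrite odd_double doubleK => /esym/eqP; rewrite mulf_eq0 signr_eq0 /=.
  by move/eqP.
have cross0 s : (s < n.*2)%N ->
    (if (s < n)%N then y s.+1 else z (s - n).+1) = 0.
  move=> hs; have := antidiag_dir_cross a y z d hs.
  rewrite hc //.
  by case: ifP => _ /esym/eqP; rewrite mulf_eq0 signr_eq0 /= => /eqP.
have z0 k : (0 < k <= n)%N -> z k = 0.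
  move=> hk; have hs : (n + k.-1 < n.*2)%N by lia.
  have := cross0 _ hs; rewrite ifF; last lia.
  by rewrite (_ : (n + k.-1 - n).+1 = k)%N; last lia.
have y0 k : (k < n)%N -> y k.+1 = 0.
  by move=> hk; have := cross0 k; rewrite hk; apply; lia.
have cc0 k l : cross_coef m n y z k l = 0.
  rewrite /cross_coef; rewrite [X in _ - X](_ : _ = 0) ?subr0; last first.
    case: ifP => // h; rewrite /z_cross; case: eqP => // e; apply: z0; lia.
  case: ifP => [/andP[_ h]|_]; first exact: y0.
  case: ifP => // h; apply: z0; move: h; rewrite /z_top; case: ifP; lia.
apply: (gram_ext hn) => b k b' l hk hl; rewrite gram_slice_dir //.
rewrite /gram mulmx0 mulmx0 mul0mx mxE /slice_coef.
case: b {hk}; case: b' {hl} => //; case: ifP => // /andP[_ h].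
  exact: (diag0 true).
exact: (diag0 false).
Qed.

Lemma sp_slice_dir a y z d : sp (slice_dir m n a y z d).
Proof.
apply: (sp_gram hn) => b k b' l hk hl; rewrite !gram_slice_dir //.
rewrite /slice_coef; case: b {hk}; case: b' {hl} => //; rewrite [l == k]eq_sym;
  by case: (altP (k =P l)) => [->|].
Qed.

Lemma slice_dir_linear (c : C) a y z d a' y' z' d' :
  c *: slice_dir m n a y z d + slice_dir m n a' y' z' d' =
  slice_dir m n (fun i => c * a i + a' i) (fun i => c * y i + y' i)
            (fun i => c * z i + z' i) (fun i => c * d i + d' i).
Proof.
apply: (gram_ext hn) => b k b' l hk hl; rewrite gram_linear !gram_slice_dir //.
have lin (u u' v v' : C) : c * (u - v) + (u' - v') = (c * u + u') - (c * v + v').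
  by rewrite mulrBr opprD addrACA.
have crossE i j : cross_coef m n (fun i => c * y i + y' i) (fun i => c * z i + z' i) i j =
    c * cross_coef m n y z i j + cross_coef m n y' z' i j.
  rewrite /cross_coef /z_cross lin; congr (_ - _).
    by case: ifP => _ //; case: ifP => _ //; rewrite mulr0 addr0.
  by case: ifP => _; [case: ifP => _ //|]; rewrite mulr0 addr0.
rewrite /slice_coef; case: b {hk}; case: b' {hl}; rewrite ?crossE //;
  by case: ifP => // _; rewrite mulr0 addr0.
Qed.

(** The coordinates of the slice direction with the same antidiagonal sums as Y,
    read from antidiag_dir_diag and antidiag_dir_cross. *)
Definition diag_coord Y b i : C :=
  (-1) ^+ (chain_half m n b - i) * antidiag Y b b (chain_half m n b - i).*2.
Definition y_coord Y i : C := (-1) ^+ i.-1 * antidiag Y true false i.-1.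
Definition z_coord Y i : C := (-1) ^+ n.-1 * antidiag Y true false (n + i.-1).

(** What remains of Y once the slice direction with the same antidiagonal sums has
    been removed: for Y in sp this is a bracket with X, and it is 0 for a slice direction. *)
Definition slice_residual Y : 'M[C]_(m + m) :=
  Y - slice_dir m n (diag_coord Y true) (y_coord Y) (z_coord Y) (diag_coord Y false).

Lemma antidiag_residual Y b b' s :
  antidiag (slice_residual Y) b b' s = antidiag Y b b' s - antidiag
    (slice_dir m n (diag_coord Y true) (y_coord Y) (z_coord Y) (diag_coord Y false))
    b b' s.
Proof. by rewrite /slice_residual [Y - _]addrC -scaleN1r antidiag_linear mulN1r addrC. Qed.

Lemma antidiag_residual_diag Y b s : sp Y -> (s < len b)%N ->
  antidiag (slice_residual Y) b b s = 0.
Proof.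
move=> hY hs; rewrite antidiag_residual antidiag_dir_diag //; case: ifP => os.
  by rewrite subr0 antidiag_sym.
have -> : (if b then diag_coord Y true else diag_coord Y false) = diag_coord Y b.
  by case: b {hs}.
rewrite /diag_coord (_ : (_ - (_ - _) = s./2)%N); last first.
  by move: hs; rewrite /chain_len; lia.
rewrite mulrA -expr2 sqrr_sign mul1r even_halfK ?subrr //; lia.
Qed.

Lemma antidiag_residual_cross Y s : (s < n.*2)%N ->
  antidiag (slice_residual Y) true false s = 0.
Proof.
move=> hs; rewrite antidiag_residual antidiag_dir_cross //; case: ifP => sn.
  by rewrite /y_coord /= mulrA -expr2 sqrr_sign mul1r subrr.
rewrite /z_coord /= mulrA -expr2 sqrr_sign mul1r subnKC ?subrr //; lia.
Qed.

Lemma slice_residual_dir a y z d : slice_residual (slice_dir m n a y z d) = 0.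
Proof.
have [a' [y' [z' [d' e]]]] : exists a' y' z' d',
    slice_residual (slice_dir m n a y z d) = slice_dir m n a' y' z' d'.
  rewrite /slice_residual addrC -scaleN1r slice_dir_linear; by do 4!eexists.
rewrite e; apply: slice_dir_eq0 => [b|] s hs; rewrite -e.
  exact: antidiag_residual_diag (sp_slice_dir _ _ _ _) hs.
exact: antidiag_residual_cross.
Qed.

Lemma slice_dir_transverse a y z d Z :
  slice_dir m n a y z d = Z *m X - X *m Z -> slice_dir m n a y z d = 0.
Proof.
move=> E; apply: slice_dir_eq0 => [b|] s hs; rewrite E antidiag_bracket //.
by rewrite /chain_len /=; move: hn; lia.
Qed.

Lemma slice_dir_complement Y : sp Y ->
  exists a y z d Z, sp Z /\ Y = slice_dir m n a y z d + (Z *m X - X *m Z).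
Proof.
move=> hY; have [| |s|Z hZ e] := @bracket_of_antidiag0 (slice_residual Y).
- rewrite /slice_residual addrC -scaleN1r.
  by apply: (sp_linear hn) => //; exact: sp_slice_dir.
- by move=> b s; exact: antidiag_residual_diag.
- exact: antidiag_residual_cross.
exists (diag_coord Y true), (y_coord Y), (z_coord Y), (diag_coord Y false), Z.
by split=> //; rewrite e /slice_residual addrC subrK.
Qed.

End Transversality.

(** * Affine subspaces as submanifolds *)

Section AffineGeometry.
Variables (K : numFieldType) (V : normedModType K).
Implicit Types (W : set V) (x v : V).

(** One chart, a translation, straightens the whole affine subspace. *)
Lemma affine_complex_submanifold x W : linear_subspace W ->
  complex_submanifold [set x + w | w in W].
Proof.
move=> lW; exists W; split => // p _.
exists setT, (fun v => v - x), (fun v => v + x); split => //.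
- split; first exact: openT.
  by move=> v _; apply: differentiableB; [exact: ex_diff|exact: differentiable_cst].
- have -> : [set v - x | v in setT] = setT.
    by apply/seteqP; split => // v _; exists (v + x); rewrite ?addrK.
  split; first exact: openT.
  by move=> v _; apply: differentiableD; [exact: ex_diff|exact: differentiable_cst].
- by move=> v _; rewrite subrK.
- move=> v _; split=> [[w Ww <-]|Wv]; first by rewrite addrC addKr.
  by exists (v - x) => //; rewrite addrC subrK.
Qed.

(** Difference quotients of a curve in x + W lie in W, and so does their limit as W
    is closed; conversely v is the velocity of t -> x + t v. *)
Lemma affine_tangent_space x W : linear_subspace W -> closed W ->
  tangent_space [set x + w | w in W] x = W.
Proof.
move=> [W0 WD] cW.
have WZ c w : W w -> W (c *: w) by move=> Ww; rewrite -[c *: w]addr0; exact: WD.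
have WB u w : W u -> W w -> W (u - w).
  by move=> Wu Ww; rewrite addrC -scaleN1r; exact: WD.
apply/seteqP; split => v /=.
  case=> gamma [g0 gS gD <-].
  have gd : derivable gamma 0 1 by exact: (nbhs_singleton gD).
  apply: (closed_cvg _ cW _ _ gd).
  have H : \forall h \near (0 : K)^', [set x + w | w in W] (gamma h).
    exact: cvg_within.
  near=> h.
  have [w Ww e] : [set x + w | w in W] (gamma h) by near: h.
  have [w0 Ww0 e0] : [set x + w | w in W] (gamma 0) by exact: (nbhs_singleton gS).
  rewrite /= addr0 [h *: 1]mulr1 -e -e0 opprD addrACA subrr add0r.
  exact/WZ/WB.
move=> Wv; exists (fun t => x + t *: v).
have quot (t : K) : (fun h => h^-1 *: ((x + (h *: 1 + t) *: v) - (x + t *: v)))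
    @ (0 : K)^' --> v.
  apply: (@cvg_trans _ ((fun=> v) @ (0 : K)^')); last exact: cvg_cst.
  apply: near_eq_cvg; near=> h; have h0 : h != 0 by near: h; exact: nbhs_dnbhs_neq.
  rewrite /= [h *: 1]mulr1 opprD addrACA subrr add0r -scalerBl addrK.
  by rewrite scalerA mulVf // scale1r.
split.
- by rewrite scale0r addr0.
- by near=> t; exists (t *: v) => //; exact: WZ.
- by near=> t; apply/cvg_ex; exists v; exact: quot.
- by apply/cvg_lim; [exact: norm_hausdorff|exact: quot].
Unshelve. all: by end_near. Qed.

End AffineGeometry.

(** * Topology of matrix spaces *)

Section MatrixTopology.
Variable K : numFieldType.

Lemma cvg_mx (T : Type) (F : set_system T) (FF : Filter F) p q
    (u : T -> 'M[K]_(p, q)) (l : 'M[K]_(p, q)) :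
  (forall i j, u t i j @[t --> F] --> l i j) -> u @ F --> l.
Proof.
move=> H; apply/cvg_ballP => e e0.
have : \forall t \near F, forall ij : 'I_p * 'I_q, ball (l ij.1 ij.2) e (u t ij.1 ij.2).
  by apply: filter_forall => -[i j] /=; move/cvg_ballP: (H i j); apply.
by apply: filterS => t Ht; split => // i j; exact: (Ht (i, j)).
Qed.

(** A linear map is a finite sum of coordinates times constants. *)
Lemma linear_mx_continuous p q p' q' (f : {linear 'M[K]_(p, q) -> 'M[K]_(p', q')}) :
  continuous f.
Proof.
move=> M; apply: (@cvg_mx _ (nbhs M) (nbhs_filter M)) => i j.
have fE N : f N i j = \sum_a \sum_b N a b * f (delta_mx a b) i j.
  rewrite [in LHS](matrix_sum_delta N) linear_sum summxE; apply: eq_bigr => a _.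
  by rewrite linear_sum summxE; apply: eq_bigr => b _; rewrite linearZ mxE.
under eq_fun do rewrite fE; rewrite fE.
apply: cvg_big => [|a _]; first exact: add_continuous.
apply: cvg_big => [|b _]; first exact: add_continuous.
apply: cvgMr_tmp.
exact: coord_continuous.
Qed.

Lemma closed_mx_ker p q p' q' (f : {linear 'M[K]_(p, q) -> 'M[K]_(p', q')}) :
  closed [set M | f M = 0].
Proof.
rewrite (_ : [set M | f M = 0] = f @^-1` [set 0]) //.
apply: preimage_closed; last exact/accessible_closed_set1/hausdorff_accessible/norm_hausdorff.
by move=> M _; exact: linear_mx_continuous.
Qed.

End MatrixTopology.

(** * The slice is a transverse affine subspace *)

Section SliceGeometry.
Variables (R : realType) (m n : nat) (hn : (n.*2 <= m)%N).
Local Notation C := R[i].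
Local Notation X := (nilX R hn).
Local Notation slice_residual := (@slice_residual R m n).
Local Notation diag_coord := (@diag_coord R m n).
Local Notation y_coord := (@y_coord R m n).
Local Notation z_coord := (@z_coord R m n).
Local Notation slice_dir := (slice_dir m n).
Implicit Types (a y z d : nat -> C) (Y Z : 'M[C]_(m + m)).

Definition slice_directions : set 'M[C]_(m + m) :=
  [set w | exists a y z d, w = slice_dir a y z d].

Lemma slice_setE : slice_set R hn = [set X + w | w in slice_directions].
Proof.
apply/seteqP; split => Y /=.
  move=> [a [y [z [d ->]]]]; rewrite slice_mx_dir.
  by eexists; last reflexivity; do 4!eexists.
move=> [_ [a [y [z [d ->]]]] <-].
pose d' := fun j => if (n.*2 == m) && (j == 1%N) then d 1%N + z n ^+ 2 else d j.
exists a, y, z, d'; rewrite slice_mx_dir; congr (_ + slice_dir _ _ _ _).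
apply/funext => j; rewrite /d'; case: andP => // -[/eqP -> /eqP ->].
by rewrite !eqxx /= addrK.
Qed.

Lemma linear_slice_directions : linear_subspace slice_directions.
Proof.
split.
  have := slice_dir_linear hn (-1 : C) (fun=> 0) (fun=> 0) (fun=> 0) (fun=> 0)
    (fun=> 0) (fun=> 0) (fun=> 0) (fun=> 0).
  by rewrite scaleN1r addNr => ->; do 4!eexists.
move=> c _ _ [a [y [z [d ->]]]] [a' [y' [z' [d' ->]]]].
by rewrite (slice_dir_linear hn); do 4!eexists.
Qed.

Lemma slice_residual_linear : linear slice_residual.
Proof.
move=> c Y Z.
have Ed b : diag_coord (c *: Y + Z) b = fun i => c * diag_coord Y b i + diag_coord Z b i.
  by apply/funext => i; rewrite /diag_coord antidiag_linear mulrDr mulrCA.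
have Ey : y_coord (c *: Y + Z) = fun i => c * y_coord Y i + y_coord Z i.
  by apply/funext => i; rewrite /y_coord antidiag_linear mulrDr mulrCA.
have Ez : z_coord (c *: Y + Z) = fun i => c * z_coord Y i + z_coord Z i.
  by apply/funext => i; rewrite /z_coord antidiag_linear mulrDr mulrCA.
rewrite /slice_residual !Ed Ey Ez -(slice_dir_linear hn).
by rewrite scalerBr opprD addrACA.
Qed.

HB.instance Definition _ := GRing.isLinear.Build C 'M[C]_(m + m) 'M[C]_(m + m)
  *:%R slice_residual slice_residual_linear.

Lemma closed_slice_directions : closed slice_directions.
Proof.
rewrite (_ : slice_directions = [set Y | slice_residual Y = 0]).
  exact: closed_mx_ker.
apply/seteqP; split => [_ [a [y [z [d ->]]]]|Y /eqP] /=.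
  exact: (slice_residual_dir hn).
by rewrite subr_eq0 => /eqP ->; do 4!eexists.
Qed.

Lemma slice_transverse : transverse_slice X (slice_set R hn).
Proof.
have lW := linear_slice_directions; have [W0 _] := lW.
rewrite slice_setE; split.
- by exists 0; rewrite ?addr0.
- move=> _ [_ [a [y [z [d ->]]]] <-].
  by rewrite -[X]scale1r; apply: (sp_linear hn); [exact: sp_nilX|exact: sp_slice_dir].
- exact: affine_complex_submanifold.
rewrite affine_tangent_space //; last exact: closed_slice_directions.
split; apply/seteqP; split => Y /=.
- by move=> [[a [y [z [d ->]]]] [Z _ /esym e]]; exact: slice_dir_transverse e.
- move=> ->; split; first exact: W0.
  exists 0; first exact: (sp0 _ hn).
  by rewrite mul0mx mulmx0 subrr.
- move=> /(slice_dir_complement hn)[a [y [z [d [Z [hZ ->]]]]]].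
  exists (slice_dir a y z d); first by do 4!eexists.
  by exists (Z *m X - X *m Z) => //; exists Z.
- move=> [_ [a [y [z [d ->]]]] [_ [Z hZ <-] <-]].
  rewrite -[slice_dir _ _ _ _]scale1r; apply: (sp_linear hn).
    exact: sp_slice_dir.
  exact: sp_bracket.
Qed.
End SliceGeometry.

(** * The complex exponential *)

Section ExponentialPartialSums.
Variable F : numFieldType.

Definition exp_sum (x : F) (N : nat) : F := \sum_(0 <= k < N) x ^+ k / k`!%:R.

(** The terms of the product of the partial sums of exp x and exp y that lie outside
    the triangle k + l < N, which is the partial sum of exp (x + y). *)
Definition exp_defect (x y : F) (N : nat) : F :=
  \sum_(0 <= k < N) \sum_(N - k <= l < N) (x ^+ k / k`!%:R) * (y ^+ l / l`!%:R).

Lemma exp_sumM x y N :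
  exp_sum x N * exp_sum y N = exp_sum (x + y) N + exp_defect x y N.
Proof.
have -> : exp_sum (x + y) N = \sum_(0 <= k < N) \sum_(0 <= l < N - k)
    (x ^+ k / k`!%:R) * (y ^+ l / l`!%:R).
  rewrite -(sum_antidiag (fun k l => (x ^+ k / k`!%:R) * (y ^+ l / l`!%:R))).
  apply: eq_bigr => s _; rewrite addrC exprDn mulr_suml big_mkord.
  apply: eq_bigr => k _; have hk : (k <= s)%N by rewrite -ltnS.
  rewrite -(bin_fact hk) !natrM mulr_natr -mulr_natl -[_ *+ _]mulr_natl.
  have u (j : nat) : j`!%:R != 0 :> F by rewrite pnatr_eq0 -lt0n fact_gt0.
  have u' : 'C(s, k)%:R != 0 :> F by rewrite pnatr_eq0 -lt0n bin_gt0.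
  field; rewrite ?u ?u' //.
rewrite /exp_sum mulr_suml -big_split /=; apply: eq_big_nat => k /andP[_ hk].
rewrite mulr_sumr (big_cat_nat (n := N - k)) ?leq_subr //=.
Qed.

(** All the coefficients are positive, so the defect is dominated by that of the
    norms, for which the real exponential gives the limit. *)
Lemma norm_exp_defect x y N : `|exp_defect x y N| <= exp_defect `|x| `|y| N.
Proof.
apply: (le_trans (ler_norm_sum _ _ _)); apply: ler_sum => k _.
apply: (le_trans (ler_norm_sum _ _ _)); apply: ler_sum => l _.
by rewrite !normrM !normfV !normrX !normr_nat.
Qed.

End ExponentialPartialSums.

Section ComplexExponential.
Variable R : realType.
Local Notation C := R[i].

Lemma cvg_complex (u : nat -> C) (l : C) (r : nat -> R) :
  (forall N, `|l - u N| <= (r N)%:C%C) -> r @ \oo --> 0 -> u @ \oo --> l.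
Proof.
move=> hu hr; apply/cvgrPdist_lt => e e0.
have eE : e = (complex.Re e)%:C%C by rewrite RRe_real // gtr0_real.
have e0' : 0 < complex.Re e by move: e0; rewrite {1}eE ltcR.
move/cvgrPdist_lt: hr => /(_ _ e0'); apply: filterS => N.
rewrite sub0r normrN => h; apply: (le_lt_trans (hu N)); rewrite eE ltcR.
exact: le_lt_trans (ler_norm _) h.
Qed.

Lemma normC_real (w : C) : `|w| = (complex.Re `|w|)%:C%C.
Proof. by rewrite RRe_real // normr_real. Qed.

Lemma exp_sum_real (x : R) N : exp_sum (x%:C%C) N = (exp_sum x N)%:C%C.
Proof.
rewrite /exp_sum rmorph_sum; apply: eq_bigr => k _ /=.
by rewrite rmorphM fmorphV rmorphXn rmorph_nat.
Qed.

Lemma exp_defect_real (x y : R) N : exp_defect (x%:C%C) (y%:C%C) N = (exp_defect x y N)%:C%C.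
Proof.
have := exp_sumM (x%:C%C) (y%:C%C) N; rewrite -rmorphD /= !exp_sum_real -rmorphM exp_sumM.
by rewrite rmorphD /= => /addrI.
Qed.

Lemma exp_sum_cvg (x : R) : exp_sum x @ \oo --> expR x.
Proof. exact: is_cvg_series_exp_coeff. Qed.

Lemma exp_defect_cvg0 (x y : R) : exp_defect x y @ \oo --> 0.
Proof.
have -> : exp_defect x y = (fun N => exp_sum x N * exp_sum y N - exp_sum (x + y) N).
  by apply/funext => N; rewrite exp_sumM addrC addKr.
rewrite -(subrr (expR (x + y))) {1}expRD; apply: cvgB; last exact: exp_sum_cvg.
by apply: cvgM; exact: exp_sum_cvg.
Qed.

(** Real and imaginary parts are dominated by the exponential series of the norm. *)
Lemma cvg_cexp (w : C) : exp_sum w @ \oo --> cexp w.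
Proof.
suff [l hl] : exists l : C, exp_sum w @ \oo --> l.
  have -> // : cexp w = l by apply: (cvg_lim (@norm_hausdorff _ _) hl).
pose t k : C := w ^+ k / k`!%:R.
pose rho := complex.Re `|w|.
have rho0 : 0 <= rho by rewrite /rho normc_def /= sqrtr_ge0.
have tn k : `|t k| = (rho ^+ k / k`!%:R)%:C%C.
  rewrite /t normrM normfV normrX normr_nat {1}normC_real.
  by rewrite -rmorphXn -[k`!%:R](rmorph_nat (real_complex R)) -fmorphV -rmorphM.
have dom (g : nat -> R) : (forall k, `|g k|%:C%C <= `|t k|) -> cvgn (series g).
  move=> hg; apply: normed_cvg; apply: (series_le_cvg (v_ := exp_coeff rho)) => //.
  - by move=> k; exact: normr_ge0.
  - by move=> k; exact: exp_coeff_ge0.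
  - by move=> k; rewrite -lecR; apply: le_trans (hg k) _; rewrite tn.
  - exact: is_cvg_series_exp_coeff.
have cre := dom (fun k => complex.Re (t k)) (fun k => normc_ge_Re (t k)).
have cim : cvgn (series (fun k => complex.Im (t k))).
  apply: dom => k; have := normc_ge_Re ('i%C * t k).
  rewrite normrM normCi mul1r; case: (t k) => a b /=.
  by rewrite mul0r sub0r mul1r normrN.
move/cvg_ex: cre => [a ha]; move/cvg_ex: cim => [b hb].
exists (a +i* b)%C.
apply: (@cvg_complex _ _ (fun N => `|a - series (fun k => complex.Re (t k)) N|
   + `|b - series (fun k => complex.Im (t k)) N|)).
  move=> N; have normR (x : R) : `|x%:C%C| = `|x|%:C%C.
    by rewrite normc_def /= expr0n addr0 sqrtr_sqr.
  have -> : (a +i* b)%C - exp_sum w N =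
      (a - series (fun k => complex.Re (t k)) N)%:C%C
      + 'i%C * (b - series (fun k => complex.Im (t k)) N)%:C%C.
    rewrite /series /= -!raddf_sum -/(exp_sum w N); case: (exp_sum w N) => p q.
    by simpc.
  apply: le_trans (ler_normD _ _) _; rewrite normrM normCi mul1r !normR.
  by rewrite (rmorphD (real_complex R)).
have dist0 (g : nat -> R) (l : R) : g @ \oo --> l -> (fun N => `|l - g N|) @ \oo --> 0.
  move=> hg; rewrite -[0](normr0 R) -(subrr l).
  by apply: cvg_norm; apply: cvgB => //; exact: cvg_cst.
by rewrite -[0]addr0; apply: cvgD; exact: dist0.
Qed.

Lemma cexpD (u v : C) : cexp (u + v) = cexp u * cexp v.
Proof.
have hd : exp_defect u v @ \oo --> 0.
  apply: (@cvg_complex _ _ (exp_defect (complex.Re `|u|) (complex.Re `|v|))).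
    move=> N; rewrite sub0r normrN -exp_defect_real -!normC_real.
    exact: norm_exp_defect.
  exact: exp_defect_cvg0.
have h1 : (fun N => exp_sum u N * exp_sum v N) @ \oo --> cexp u * cexp v.
  by apply: cvgM; exact: cvg_cexp.
have h2 : (fun N => exp_sum u N * exp_sum v N) @ \oo --> cexp (u + v) + 0.
  under eq_fun do rewrite exp_sumM.
  by apply: cvgD; [exact: cvg_cexp|exact: hd].
rewrite -[LHS]addr0; apply: (cvg_unique _ h2 h1); exact: norm_hausdorff.
Qed.

Lemma cexp0 : cexp (0 : C) = 1.
Proof.
apply: (cvg_lim (@norm_hausdorff _ _)).
apply: (@cvg_trans _ ((fun=> 1 : C) @ \oo)); last exact: cvg_cst.
apply: near_eq_cvg; near=> N; have N0 : (0 < N)%N by near: N; exists 1%N.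
rewrite /series /= -(prednK N0) big_nat_recl //= expr0 divr1 big1 ?addr0 // => k _.
by rewrite expr0n mul0r.
Unshelve. all: by end_near. Qed.

Lemma cexpN (u : C) : cexp u * cexp (- u) = 1.
Proof. by rewrite -cexpD subrr cexp0. Qed.

Lemma cexpMn (u : C) k : cexp (u *+ k) = cexp u ^+ k.
Proof.
by elim: k => [|k IH]; rewrite ?cexp0 // mulrS cexpD IH exprS.
Qed.

End ComplexExponential.

(** * Invariance under the contracting action *)

Section LambdaInvariance.
Variables (R : realType) (m n : nat) (hn : (n.*2 <= m)%N).
Local Notation C := R[i].
Local Notation chain := (chain m n C).
Local Notation half := (chain_half m n).
Local Notation len := (chain_len m n).
Local Notation X := (nilX R hn).
Local Notation H := (ssH R hn).
Local Notation gram := (gram n).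
Implicit Types (a y z d : nat -> C) (Y : 'M[C]_(m + m)) (u w r : C).

Lemma mxexp_diag (D : 'rV[C]_(m + m)) :
  mxexp (diag_mx D) = diag_mx (map_mx (@cexp R) D).
Proof.
have pow k i j : (diag_mx D ^+ k) i j = (D 0 i ^+ k) *+ (i == j).
  have -> : diag_mx D ^+ k = diag_mx (map_mx (fun x => x ^+ k) D).
    elim: k => [|k IH].
      apply/matrixP => x y; rewrite expr0 !mxE; by case: eqP.
    rewrite exprS IH; apply/matrixP => x y; rewrite [LHS]mxE (bigD1 x) //= !mxE.
    rewrite eqxx mulr1n big1 ?addr0 => [|x' nx]; last first.
      by rewrite !mxE eq_sym (negbTE nx) mul0r.
    by rewrite exprS mulrnAr.
  by rewrite !mxE.
apply: (cvg_lim (@norm_hausdorff _ _)); apply: cvg_mx => i j.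
rewrite !mxE; case: (altP (i =P j)) => [<-|nij].
  rewrite mulr1n.
  rewrite (_ : (fun N => _) = exp_sum (D 0 i)); first exact: cvg_cexp.
  apply/funext => N; rewrite /series /= summxE; apply: eq_bigr => k _.
  by rewrite mxE pow eqxx mulr1n mulrC.
rewrite mulr0n (_ : (fun N => _) = fun=> 0); first exact: cvg_cst.
apply/funext => N; rewrite /series /= summxE big1 // => k _.
by rewrite mxE pow (negbTE nij) mulr0n mulr0.
Qed.

(** Eigenvalue of H on the vector k of a chain. *)
Definition chain_weight b k : C := (len b).-1%:R - k.*2%:R.

Lemma chain_weight_rev b k : (k < len b)%N ->
  chain_weight b ((len b).-1 - k) = - chain_weight b k.
Proof.
move=> hk; rewrite /chain_weight opprB -addnn natrD -[k.*2]addnn natrB; last lia.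
by rewrite natrD; ring.
Qed.

Lemma ssH_pos b k (i : 'I_(m + m)) : (k < len b)%N -> i = chain_pos m n b k :> nat ->
  row_mx (half_weights R hn) (- half_weights R hn) 0 i = chain_weight b k.
Proof.
have hw (j : 'I_m) b' l : (l < half b')%N -> j = (chain_offset m n b' + l)%N :> nat ->
    half_weights R hn 0 j = chain_weight b' l.
  move=> hl hj; rewrite /half_weights castmxE /= cast_ord_id mxE.
  have wE (p q : nat) : (q < p)%N ->
      (p.*2 - (q.*2).+1)%:R = (p.*2.-1)%:R - q.*2%:R :> C.
    move=> hq; rewrite -natrB; last lia.
    by congr (_%:R); lia.
  rewrite /chain_weight /chain_len.
  case: splitP => j' /= ej; rewrite mxE; rewrite hj in ej;
    case: b' hl ej {hj} => /= hl ej.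
  - by have := ltn_ord j'; rewrite -ej ltnNge leq_addr.
  - by rewrite -ej add0n wE.
  - by move/addnI: ej => <-; rewrite wE.
  - by exfalso; move: hl; rewrite -[l]add0n ej ltnNge leq_addr.
move=> hk; rewrite /chain_pos mxE; case: ifP => h hi.
  case: splitP => j ej; first by apply: hw => //; rewrite -ej.
  by have := leq_addr j m; rewrite -ej hi; move: h hn;
    rewrite /chain_half /chain_offset; case: b {hk hi}; lia.
case: splitP => j ej; first by have := ltn_ord j; rewrite -ej hi ltnNge leq_addr.
rewrite mxE (hw _ b ((len b).-1 - k)%N).
- by rewrite chain_weight_rev // opprK.
- by move: hk h; rewrite /chain_len; lia.
- by move: ej; rewrite hi => /addnI.
Qed.

Lemma mxexp_chain u b k : (k < len b)%N ->
  mxexp (u *: H) *m chain b k = cexp (u * chain_weight b k) *: chain b k.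
Proof.
move=> hk; have -> : u *: H = diag_mx (u *: row_mx (half_weights R hn) (- half_weights R hn)).
  by rewrite linearZ.
rewrite mxexp_diag; apply/matrixP => i j; rewrite mul_diag_mx !mxE ord1 /chain hk !mxE.
case: (altP (i =P chain_pos m n b k :> nat)) => [e|_]; last by rewrite !mulr0.
by rewrite -(ssH_pos hk e) mxE.
Qed.

Lemma chain_mxexp u b k : (k < len b)%N ->
  (chain b k)^T *m mxexp (u *: H) = cexp (u * chain_weight b k) *: (chain b k)^T.
Proof.
move=> hk; apply: trmx_inj; rewrite trmx_mul trmxK [RHS]linearZ /= trmxK -mxexp_chain //.
congr (_ *m _); have -> : u *: H = diag_mx (u *: row_mx (half_weights R hn) (- half_weights R hn)).
  by rewrite linearZ.
by rewrite mxexp_diag tr_diag_mx.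
Qed.

(** In exponential form, because the weights may be negative while w is an
    arbitrary determination of log r. *)
Definition lambda_factor r w b k b' l : C :=
  r * cexp (w / 2 * (chain_weight b k + chain_weight b' l)).

Lemma gram_lambda r w Y b k b' l : (k < len b)%N -> (l < len b')%N ->
  gram (lambda H r w Y) b k b' l = lambda_factor r w b k b' l * gram Y b k b' l.
Proof.
move=> hk hl; have hk' : ((len b).-1 - k < len b)%N by lia.
have conj (s c : C) (u : 'rV[C]_(m + m)) (v : 'cV[C]_(m + m)) (E E' : 'M[C]_(m + m)) :
    (s *: u) *m (c *: (E *m Y *m E')) *m v = (c * s) *: ((u *m E) *m Y *m (E' *m v)).
  by rewrite -scalemxAr -!scalemxAl scalerA !mulmxA.
rewrite /gram /lambda !mulmxA !chain_sympl // conj chain_mxexp // mxexp_chain //.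
rewrite chain_weight_rev // mulrNN -!scalemxAl -scalemxAr !scalerA !mxE.
by rewrite /lambda_factor (mulrDr _ (chain_weight b k)) cexpD; ring.
Qed.

(** The exponent is an integer since both weights are odd. *)
Lemma lambda_factorE r w b k b' l : cexp w = r ->
  (k < len b)%N -> (l < len b')%N -> (k + l <= half b + half b')%N ->
  lambda_factor r w b k b' l = r ^+ (half b + half b' - (k + l)).
Proof.
move=> er hk hl hkl; rewrite /lambda_factor.
set e := (half b + half b' - (k + l))%N.
have -> : w / 2 * (chain_weight b k + chain_weight b' l) = w *+ e - w.
  have eE : e%:R = (half b)%:R + (half b')%:R - (k%:R + l%:R) :> C.
    by rewrite /e natrB // !natrD.
  have pred_len c j : (j < len c)%N -> (len c).-1%:R = (half c)%:R *+ 2 - 1 :> C.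
    by move=> h; rewrite -subn1 natrB; [rewrite /chain_len -mul2n natrM mulr_natl|lia].
  rewrite -[w *+ e]mulr_natr eE /chain_weight (pred_len _ _ hk) (pred_len _ _ hl).
  by rewrite -!mul2n !natrM; field.
by rewrite cexpD cexpMn er mulrCA -er cexpN mulr1.
Qed.

(** X lives on the positions k + l = p + p', where lambda_factor is 1. *)
Lemma gram_nilX b k b' l : (k < len b)%N -> (l < len b')%N ->
  (k + l != half b + half b')%N -> gram X b k b' l = 0.
Proof.
move=> hk hl hkl; rewrite /gram mulmxA chain_sympl // -mulmxA.
rewrite nilX_chain //; case: l hl hkl => [|l] hl hkl; first by rewrite mulmx0 mxE.
rewrite -scalemxAl chain_orth // (_ : [&& _, _ & _] = false) ?raddf0 ?scaler0 ?mxE //.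
apply/negbTE/negP => /and3P[/eqP eb /eqP ekl _]; move: hkl hl hk; rewrite -eb -ekl /chain_len.
lia.
Qed.

Lemma lambda_linear r w (c : C) Y Z :
  lambda H r w (c *: Y + Z) = c *: lambda H r w Y + lambda H r w Z.
Proof.
by rewrite /lambda mulmxDr mulmxDl -scalemxAr -scalemxAl scalerDr !scalerA [r * c]mulrC.
Qed.

Lemma lambda_nilX r w : cexp w = r -> lambda H r w X = X.
Proof.
move=> er; apply: (gram_ext hn) => b k b' l hk hl.
have [e|ne] := eqVneq (k + l)%N (half b + half b')%N.
  by rewrite gram_lambda // lambda_factorE ?e ?leqnn // subnn expr0 mul1r.
by rewrite gram_lambda // gram_nilX ?mulr0.
Qed.

(** The exponents p + p' - k - l at the positions of the coordinates: 2i for a_i and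
    d_i, m+1-i for y_i and m-n+1-i for z_i. *)
Lemma lambda_slice_dir r w a y z d : cexp w = r ->
  lambda H r w (slice_dir m n a y z d) =
  slice_dir m n (fun i => r ^+ i.*2 * a i) (fun i => r ^+ (m.+1 - i) * y i)
    (fun i => r ^+ (m.+1 - n - i) * z i) (fun i => r ^+ i.*2 * d i).
Proof.
move=> er; apply: (gram_ext hn) => b k b' l hk hl.
rewrite gram_lambda // !gram_slice_dir //.
have F := lambda_factorE er hk hl.
have zt : (z_top m n <= n)%N by rewrite /z_top; case: ifP; lia.
have crossF i j (c : C) : (i < len false)%N -> (j < len true)%N ->
    ((i + j <= m)%N -> c = r ^+ (m - (i + j))) ->
    c * cross_coef m n y z i j =
    cross_coef m n (fun i => r ^+ (m.+1 - i) * y i) (fun i => r ^+ (m.+1 - n - i) * z i) i j.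
  move=> hi hj hc; rewrite /cross_coef mulrBr; congr (_ - _).
    case: ifP => [/andP[/eqP i0 hj']|_].
      by rewrite hc; [congr (r ^+ _ * _); lia|lia].
    case: ifP => [h|_]; last by rewrite mulr0.
    by rewrite hc; [congr (r ^+ _ * _); lia|lia].
  case: ifP => [h|_]; last by rewrite mulr0.
  rewrite /z_cross; case: eqP => [e|_]; last by rewrite mulr0.
  by rewrite hc; [congr (r ^+ _ * _); lia|lia].
have hm : (m - n + n = m)%N by exact: blocks_size hn.
move: hk hl F; rewrite /slice_coef; case: b; case: b' => hk hl F.
- case: ifP => [/andP[/eqP e h]|_]; last by rewrite mulr0.
  by rewrite F; [congr (r ^+ _ * _); rewrite /=; lia|rewrite /=; lia].
- apply: crossF => // h; rewrite F /=; last lia.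
  by congr (r ^+ _); lia.
- apply: crossF => // h; rewrite F /=; last lia.
  by congr (r ^+ _); lia.
- case: ifP => [/andP[/eqP e h]|_]; last by rewrite mulr0.
  by rewrite F; [congr (r ^+ _ * _); rewrite /=; lia|rewrite /=; lia].
Qed.

Lemma slice_lambda_invariant : lambda_invariant H (slice_set R hn).
Proof.
move=> r w r0 er; rewrite slice_setE.
have lamE v : lambda H r w (X + v) = X + lambda H r w v.
  by rewrite -[X in LHS]scale1r lambda_linear scale1r lambda_nilX.
apply/seteqP; split => Y /=.
  move=> [_ [_ [a [y [z [d ->]]]] <-] <-].
  rewrite lamE lambda_slice_dir //; eexists; last reflexivity.
  by do 4!eexists.
move=> [_ [a [y [z [d ->]]]] <-].
exists (X + slice_dir m n (fun i => r ^- i.*2 * a i) (fun i => r ^- (m.+1 - i) * y i)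
    (fun i => r ^- (m.+1 - n - i) * z i) (fun i => r ^- i.*2 * d i)).
  by eexists; last reflexivity; do 4!eexists.
have inv (k : nat -> nat) (c : nat -> C) :
    (fun i => r ^+ k i * (r ^- k i * c i)) = c.
  by apply/funext => i; rewrite mulVKf // expf_neq0.
rewrite lamE lambda_slice_dir //.
rewrite (inv (fun i => i.*2) a) (inv (fun i => m.+1 - i)%N y).
by rewrite (inv (fun i => m.+1 - n - i)%N z) (inv (fun i => i.*2) d).
Qed.

End LambdaInvariance.

(** * Reducing a determinant to a small block *)

Section DeterminantReduction.
Variable A : comNzRingType.

(** Sylvester: both sides are the determinant of the block matrix with diagonal
    blocks 1 and other blocks - B and D. *)
Lemma det_1addC p q (B : 'M[A]_(p, q)) (D : 'M[A]_(q, p)) :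
  \det (1%:M + B *m D) = \det (1%:M + D *m B).
Proof.
have E1 : block_mx 1%:M (- B) D 1%:M =
    block_mx 1%:M 0 D 1%:M *m block_mx 1%:M (- B) 0 (1%:M + D *m B).
  rewrite mulmx_block !(mul1mx, mulmx1, mul0mx, mulmx0, addr0, add0r).
  by rewrite mulmxN addrCA addNr addr0.
have E2 : block_mx 1%:M (- B) D 1%:M =
    block_mx (1%:M + B *m D) (- B) 0 1%:M *m block_mx 1%:M 0 D 1%:M.
  rewrite mulmx_block !(mul1mx, mulmx1, mul0mx, mulmx0, addr0, add0r).
  by rewrite mulNmx addrK.
have := congr1 determinant E1; rewrite {1}E2 !det_mulmx !det_lblock !det_ublock.
by rewrite !det1 !mul1r !mulr1.
Qed.

(** If M sends the columns of U to combinations, given by D, of a few columns F1,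
    then det D divides det M, with no sign or permutation to track.  The columns U
    replace those of the identity selected by F0, and the replacement has determinant 1. *)
Lemma det_reduction p k (M : 'M[A]_p) (U F0 F1 : 'M[A]_(p, k)) (G : 'M[A]_(k, p))
    (D : 'M[A]_k) :
  M *m U = F1 *m D -> G *m F0 = 1%:M -> G *m U = 1%:M ->
  \det M = \det (M *m (1%:M - F0 *m G) + F1 *m G) * \det D.
Proof.
move=> hU hF hG.
have dT : \det (1%:M + (U - F0) *m G) = 1.
  by rewrite det_1addC mulmxBr hG hF subrr addr0 det1.
have dD : \det (1%:M + F0 *m ((D - 1%:M) *m G)) = \det D.
  by rewrite det_1addC -mulmxA hF mulmx1 addrC subrK.
suff E : M *m (1%:M + (U - F0) *m G) =
    (M *m (1%:M - F0 *m G) + F1 *m G) *m (1%:M + F0 *m ((D - 1%:M) *m G)).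
  by have := congr1 determinant E; rewrite !det_mulmx dT dD mulr1.
rewrite [1%:M + F0 *m _](_ : _ = (1%:M - F0 *m G) + F0 *m D *m G); last first.
  by rewrite mulmxBl mul1mx mulmxBr !mulmxA addrA addrAC.
set P := 1%:M - F0 *m G.
have proj0 : P *m F0 = 0 by rewrite mulmxBl mul1mx -mulmxA hF mulmx1 subrr.
have Gproj : G *m P = 0 by rewrite mulmxBr mulmx1 mulmxA hF mul1mx subrr.
have idem : P *m P = P by rewrite {2}/P mulmxBr mulmx1 mulmxA proj0 mul0mx subr0.
have e1 : M *m P *m (P + F0 *m D *m G) = M *m P.
  by rewrite -mulmxA mulmxDr idem !mulmxA proj0 !mul0mx addr0.
have e2 : F1 *m G *m (P + F0 *m D *m G) = M *m U *m G.
  by rewrite -mulmxA mulmxDr Gproj add0r !mulmxA -(mulmxA F1 G F0) hF mulmx1 hU.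
rewrite mulmxDl e1 e2 /P mulmxDr mulmxBr mulmx1 mulmxBl mulmxBr !mulmxA.
by rewrite addrA addrAC.
Qed.

Lemma det_block11 (p q r s : A) :
  \det (block_mx p%:M q%:M r%:M s%:M : 'M[A]_(1 + 1)) = p * s - q * r.
Proof.
set M := block_mx _ _ _ _.
have ME (i j : 'I_(1 + 1)) : M i j =
    if val i == 0%N then if val j == 0%N then p else q
    else if val j == 0%N then r else s.
  by case: (split_ordP i) => i' ->; case: (split_ordP j) => j' ->;
    rewrite ?block_mxEul ?block_mxEur ?block_mxEdl ?block_mxEdr !ord1 mxE.
clearbody M; rewrite (expand_det_row _ 0) !big_ord_recl big_ord0 addr0 /cofactor !det_mx11.
by rewrite !mxE !ME /= expr0 expr1 mul1r mulN1r mulrN.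
Qed.

End DeterminantReduction.

(** * Inverting t - X modulo the last vectors of the chains *)

Section Resolvent.
Variables (R : realType) (m n : nat) (hn : (n.*2 <= m)%N).
Local Notation C := R[i].
Local Notation A := {poly R[i]}.
Local Notation pchain := (chain m n A).
Local Notation half := (chain_half m n).
Local Notation len := (chain_len m n).
Local Notation X := (nilX R hn).
Local Notation liftP := (map_mx (@polyC C)).

Definition res_mx : 'M[A]_(m + m) := 'X%:M - liftP X.

Definition chain_last b : 'cV[A]_(m + m) := pchain b (len b).-1.

(** Up to a power of t, the geometric series of X/t applied to the last vector of the
    chain; hence t - X sends it to a multiple of that vector. *)
Definition chain_gen b : 'cV[A]_(m + m) :=
  \sum_(0 <= k < len b) 'X^k *: pchain b k.

(** The coefficient of chain_last in the reduction of a vector modulo t - X, see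
    res_tail_mx. *)
Definition chain_cogen b : 'rV[A]_(m + m) :=
  \sum_(0 <= k < len b) 'X^((len b).-1 - k) *: (pchain b k)^T.

(** Up to sign, the reduction of b_k to the end of its chain, see res_tail. *)
Definition chain_tail b k : 'cV[A]_(m + m) :=
  \sum_(k.+1 <= l < len b) 'X^(l - k.+1) *: pchain b l.

Definition tail_mx : 'M[A]_(m + m) :=
  - \sum_(b : bool) \sum_(k < len b) chain_tail b k *m (pchain b k)^T.

Lemma res_chain b k : (k < len b)%N ->
  res_mx *m pchain b k = 'X *: pchain b k - (if k is l.+1 then pchain b l else 0).
Proof.
move=> hk; rewrite mulmxBl mul_scalar_mx -(map_chain _ _ (@polyC C)) -map_mxM nilX_chain //.
by case: k hk => [|k] hk; rewrite ?map_mx0 // !map_chain.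
Qed.

(** (t - X) t^l b_l is the difference of consecutive terms t^l b_(l-1). *)
Lemma telescope_res b k0 k1 : (k0 <= k1 <= len b)%N ->
  res_mx *m \sum_(k0 <= l < k1) 'X^(l - k0) *: pchain b l =
  'X^(k1 - k0) *: (if k1 is l.+1 then pchain b l else 0)
  - (if k0 is l.+1 then pchain b l else 0).
Proof.
move=> /andP[h0 h1].
rewrite mulmx_sumr (telescope_sumr_eq
  (fun l => 'X^(l - k0) *: (if l is l1.+1 then pchain b l1 else 0))) //.
  by rewrite subnn expr0 scale1r.
move=> l /andP[hl hl']; rewrite -scalemxAr res_chain ?(leq_trans hl') //.
by rewrite scalerBr scalerA subSn // exprSr.
Qed.

Lemma res_gen b : res_mx *m chain_gen b = 'X^(len b) *: chain_last b.
Proof.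
have := @telescope_res b 0 (len b); rewrite leq0n leqnn subn0 subr0 => /(_ isT).
under eq_bigr do rewrite subn0; move=> ->.
rewrite /chain_last; case E: (len b) => [|l] //.
by rewrite /chain E scaler0.
Qed.

Lemma res_tail b k : (k < len b)%N ->
  res_mx *m chain_tail b k = 'X^((len b).-1 - k) *: chain_last b - pchain b k.
Proof.
move=> hk; rewrite telescope_res ?hk ?leqnn // /chain_last.
by case: (len b) hk => [|l] //= hk; rewrite subSS.
Qed.

Lemma tail_mx_chain b k : (k < len b)%N -> tail_mx *m pchain b k = - chain_tail b k.
Proof.
move=> hk; rewrite mulNmx; congr (- _); rewrite mulmx_suml (bigD1 b) //=.
rewrite [X in _ + X]big1 ?addr0 => [|b' /negbTE nb]; last first.
  rewrite mulmx_suml big1 // => k' _.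
  by rewrite -mulmxA chain_orth // nb /= raddf0 mulmx0.
rewrite mulmx_suml (bigD1 (Ordinal hk)) //= -mulmxA chain_orth // !eqxx hk /=.
rewrite mulmx1 big1 ?addr0 // => k' nk; rewrite -mulmxA chain_orth //.
have -> : (k' == k :> nat) = false by apply/eqP => e; case/eqP: nk; apply/val_inj.
by rewrite andbF raddf0 mulmx0.
Qed.

Lemma cogen_chain b b' k : (k < len b')%N ->
  chain_cogen b *m pchain b' k = (if b == b' then 'X^((len b).-1 - k) else 0)%:M.
Proof.
move=> hk; rewrite mulmx_suml; case: (altP (b =P b')) => [eb|/negbTE nb]; last first.
  rewrite raddf0 big1 // => l _.
  by rewrite -scalemxAl chain_orth // nb /= raddf0 scaler0.
subst b'; rewrite big_mkord (bigD1 (Ordinal hk)) //= -scalemxAl chain_orth // !eqxx hk /=.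
rewrite scalemx1 big1 ?addr0 // => l nl; rewrite -scalemxAl chain_orth //.
have -> : (l == k :> nat) = false by apply/eqP => e; case/eqP: nl; apply/val_inj.
by rewrite andbF raddf0 scaler0.
Qed.

(** Climbing a chain from b_k to its end, by chain_tail, leaves only a multiple of the
    last vector. *)
Lemma res_tail_mx :
  res_mx *m tail_mx = 1%:M - \sum_(b : bool) chain_last b *m chain_cogen b.
Proof.
apply: (chain_ext hn) => b k hk; rewrite -mulmxA tail_mx_chain // mulmxN res_tail //.
rewrite opprB mulmxBl mul1mx mulmx_suml (bigD1 b) //= big1 => [|b' /negbTE nb].
  by rewrite addr0 -mulmxA cogen_chain // eqxx -mul_scalar_mx scalar_mxC.
by rewrite -mulmxA cogen_chain // nb raddf0 mulmx0.
Qed.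

Lemma chain_head_tail b : (pchain b 0)^T *m tail_mx = 0.
Proof.
rewrite mulmxN mulmx_sumr big1 ?oppr0 // => b' _.
rewrite mulmx_sumr big1 // => k _; rewrite mulmxA mulmx_sumr big_nat big1 ?mul0mx //.
move=> l /andP[hl _]; rewrite -scalemxAr chain_orth //.
by rewrite (_ : (0 == l)%N = false) ?andbF ?raddf0 ?scaler0 //; lia.
Qed.

Lemma chain_gen_coef b k b' : (k < len b)%N ->
  (pchain b k)^T *m chain_gen b' = (if b == b' then 'X^k else 0)%:M.
Proof.
move=> hk; rewrite mulmx_sumr; case: (altP (b =P b')) => [eb|/negbTE nb]; last first.
  by rewrite raddf0 big1 // => l _; rewrite -scalemxAr chain_orth // nb /= raddf0 scaler0.
subst b'; rewrite big_mkord (bigD1 (Ordinal hk)) //= -scalemxAr chain_orth // !eqxx hk /=.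
rewrite scalemx1 big1 ?addr0 // => l nl; rewrite -scalemxAr chain_orth //.
have -> : (k == l :> nat)%N = false.
  by apply/eqP => e; case/eqP: nl; apply/val_inj.
by rewrite andbF raddf0 scaler0.
Qed.

End Resolvent.

(** * Reducing t - S to the last vectors of the chains *)

Section SliceReduction.
Variables (R : realType) (m n : nat) (hn : (n.*2 <= m)%N) (m0 : (0 < m)%N).
Variables (a y z d : nat -> R[i]).
Local Notation C := R[i].
Local Notation A := {poly R[i]}.
Local Notation pchain := (chain m n A).
Local Notation half := (chain_half m n).
Local Notation len := (chain_len m n).
Local Notation X := (nilX R hn).
Local Notation liftP := (map_mx (@polyC C)).
Local Notation res_mx := (res_mx R hn).
Local Notation tail_mx := (tail_mx R m n).
Local Notation chain_gen := (chain_gen R m n).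
Local Notation chain_cogen := (chain_cogen R m n).
Local Notation chain_last := (chain_last R m n).

Let W : 'M[A]_(m + m) := liftP (slice_dir m n a y z d).
Let zc : A := (z_cross m n z)%:P.

Definition pcross : 'M[A]_(m + m) :=
  pchain true n.-1 *m (pchain false (m - n).-1)^T
  - pchain false (m - n) *m (pchain true n)^T.

Definition plower : 'M[A]_(m + m) := liftP (lower_block (slice_block m n (z_top m n) a y z d)).

Lemma lift_dir : W = plower + zc *: pcross.
Proof.
rewrite /W /slice_dir map_mxD map_mxZ; congr (_ + _ *: _).
by rewrite /cross_mx map_mxB !map_mxM -!map_trmx !map_chain.
Qed.

Lemma plower_chain b k : (half b <= k)%N -> plower *m pchain b k = 0.
Proof.
by move=> h; rewrite -(map_chain _ _ (@polyC C)) -map_mxM lower_block_chain // map_mx0.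
Qed.

Lemma chain_plower b k : (k < half b)%N -> (pchain b k)^T *m plower = 0.
Proof.
move=> h; rewrite -(map_chain _ _ (@polyC C)) map_trmx -map_mxM chain_lower_block //.
by rewrite map_mx0.
Qed.

(** Among the f_j of a chain only f_p, which is the vector b_p, may have a nonzero
    image, through cross_mx. *)
Lemma lift_dir_chain b k : (half b < k)%N -> W *m pchain b k = 0.
Proof.
move=> hk; rewrite lift_dir mulmxDl plower_chain ?(ltnW hk) // add0r -scalemxAl /pcross.
rewrite mulmxBl -!mulmxA !chain_orth //.
case: b hk => /= hk.
  rewrite raddf0 mulmx0 sub0r (_ : (n == k) = false); last lia.
  by rewrite raddf0 mulmx0 oppr0 scaler0.
rewrite raddf0 mulmx0 subr0 (_ : ((m - n).-1 == k) = false); last lia.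
by rewrite raddf0 mulmx0 scaler0.
Qed.

Lemma lift_dir_tail b k : (half b <= k)%N -> W *m chain_tail R m n b k = 0.
Proof.
move=> hk; rewrite mulmx_sumr big_nat big1 // => l /andP[hl _].
by rewrite -scalemxAr lift_dir_chain ?scaler0 //; lia.
Qed.

Lemma lift_dir_tail_mx b k : (half b <= k)%N -> W *m (tail_mx *m pchain b k) = 0.
Proof.
move=> hk; have [h|h] := ltnP k (len b).
  by rewrite tail_mx_chain // mulmxN lift_dir_tail ?oppr0.
by rewrite /chain ltnNge h /= !mulmx0.
Qed.

(** The symmetric block of the slice has its image spanned by the f_j, which tail_mx
    moves to vectors f_i with i < p; these are killed by slice directions. *)
Lemma lift_dir_tail_plower : W *m (tail_mx *m plower) = 0.
Proof.
rewrite mulNmx mulmxN mulmx_suml mulmx_sumr big1 ?oppr0 // => b _.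
rewrite mulmx_suml mulmx_sumr big1 // => k _; rewrite -[_ *m _ *m plower]mulmxA.
have [h|h] := ltnP k (half b); first by rewrite chain_plower // !mulmx0.
by rewrite [W *m _]mulmxA lift_dir_tail // mul0mx.
Qed.

(** All second order terms vanish except the square of cross_mx, which appears when
    m = 2n: there W sends e_n of the long chain to e_n of the short one, tail_mx then reaches
    f_n, and W sends it to f_n of the long chain. *)
Lemma lift_dir_second :
  W *m tail_mx *m W = zc ^+ 2 *: (pchain false (m - n) *m (pchain false (m - n).-1)^T).
Proof.
rewrite -mulmxA [in X in _ *m (_ *m X)]lift_dir mulmxDr mulmxDr lift_dir_tail_plower add0r.
have [n0|n0] := posnP n.
  have -> : zc = 0.
    by rewrite /zc /z_cross (_ : (n.*2 == m) = false) ?polyC0 //; lia.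
  by rewrite scale0r expr0n /= scale0r !mulmx0.
rewrite -!scalemxAr /pcross mulmxBr mulmxBr.
rewrite [X in _ - X](_ : _ = 0) ?subr0; last first.
  by rewrite !mulmxA -[W *m _ *m pchain false _]mulmxA lift_dir_tail_mx ?mul0mx.
rewrite !mulmxA -[W *m _ *m pchain true _]mulmxA tail_mx_chain //; last first.
  by rewrite /chain_len /=; lia.
rewrite /chain_tail prednK // big_ltn; last by rewrite /chain_len /=; lia.
rewrite subnn expr0 scale1r mulmxN mulmxDr.
rewrite [X in _ + X](_ : _ = 0) ?addr0; last first.
  rewrite mulmx_sumr big_nat big1 // => l /andP[hl _].
  by rewrite -scalemxAr lift_dir_chain ?scaler0 //; lia.
rewrite lift_dir mulmxDl plower_chain //= add0r -scalemxAl /pcross mulmxBl -!mulmxA.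
rewrite !chain_orth // !eqxx /= (_ : (n < len true)%N); last by rewrite /chain_len /=; lia.
by rewrite raddf0 mulmx0 sub0r mulmx1 scalerN opprK -scalemxAl scalerA -expr2.
Qed.

(** Two steps of the Neumann series of (t - S)^-1; by lift_dir_second the third one
    vanishes. *)
Definition slice_gen b : 'cV[A]_(m + m) :=
  chain_gen b + tail_mx *m (W *m chain_gen b + W *m tail_mx *m W *m chain_gen b).

Lemma res_slice_gen b :
  (res_mx - W) *m slice_gen b = 'X^(len b) *: chain_last b
   - \sum_(b' : bool) chain_last b' *m (chain_cogen b' *m
      (W *m chain_gen b + W *m tail_mx *m W *m chain_gen b)).
Proof.
set c := W *m chain_gen b; set c2 := W *m tail_mx *m W *m chain_gen b.
have third : W *m (tail_mx *m c2) = 0.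
  rewrite /c2 lift_dir_second -!scalemxAl -!scalemxAr -!mulmxA.
  by rewrite [tail_mx *m _]mulmxA [W *m _]mulmxA lift_dir_tail_mx // mul0mx scaler0.
have second : W *m (tail_mx *m c) = c2 by rewrite /c /c2 !mulmxA.
rewrite /slice_gen mulmxDr mulmxBl res_gen // -/c mulmxBl -addrA; congr (_ + _).
rewrite !mulmxA res_tail_mx // -!mulmxA [tail_mx *m (_ + _)]mulmxDr [W *m (_ + _)]mulmxDr.
rewrite second third addr0 mulmxBl mul1mx mulmx_suml.
under [in RHS]eq_bigr do rewrite mulmxA.
by rewrite [c + c2 - _ - c2]addrAC addrK addKr.
Qed.

End SliceReduction.

(** * The reduced matrix *)

Section CharacteristicPolynomial.
Variables (R : realType) (m n : nat) (hn : (n.*2 <= m)%N) (m0 : (0 < m)%N).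
Variables (a y z d : nat -> R[i]).
Local Notation C := R[i].
Local Notation A := {poly R[i]}.
Local Notation pchain := (chain m n A).
Local Notation half := (chain_half m n).
Local Notation len := (chain_len m n).
Local Notation X := (nilX R hn).
Local Notation liftP := (map_mx (@polyC C)).
Local Notation res_mx := (res_mx R hn).
Local Notation tail_mx := (tail_mx R m n).
Local Notation chain_gen := (chain_gen R m n).
Local Notation chain_cogen := (chain_cogen R m n).
Local Notation chain_last := (chain_last R m n).
Local Notation S := (slice_dir m n a y z d).
Local Notation W := (liftP S).
Local Notation zc := (z_cross m n z).

(** Every coordinate lies on an antidiagonal k + l = s with s less than both sides of
    its block. *)
Lemma slice_dir_support b k b' l : (k < len b)%N -> (l < len b')%N ->
  (minn (len b) (len b') <= k + l)%N -> gram n S b k b' l = 0.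
Proof.
move=> hk hl h; rewrite gram_slice_dir //.
have zt : (z_top m n <= n)%N by rewrite /z_top; case: ifP; lia.
have cross0 i j : (n.*2 <= i + j)%N -> (j < n.*2)%N -> cross_coef m n y z i j = 0.
  move=> hij hj; rewrite /cross_coef ifF; last lia.
  rewrite ifF; last lia.
  rewrite sub0r; apply/eqP; rewrite oppr_eq0; case: ifP => // h'.
  by rewrite /z_cross; case: (n.*2 =P m) => // e; exfalso; lia.
move: hk hl h; rewrite /slice_coef /chain_len /chain_half; case: b; case: b' => /= hk hl h.
- by rewrite ifF //; lia.
- by apply: cross0; move: hn; lia.
- by apply: cross0; move: hn; lia.
- by rewrite ifF //; lia.
Qed.

Definition antidiag_poly b b' : A :=
  \sum_(0 <= s < minn (len b) (len b')) (antidiag n S b b' s)%:P * 'X^s.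

(** The coefficients t^(2p-1-k) of chain_cogen match t^k on the dual vector under
    omega, so the first order term is the sum of all (-1)^k t^(k+l) gram (k, l), grouped by
    antidiagonals. *)
Lemma cogen_dir_gen b b' :
  chain_cogen b *m (W *m chain_gen b') = ((-1) ^+ (half b).+1 * antidiag_poly b b')%:M.
Proof.
pose F k l : A := 'X^(k + l) * ((-1) ^+ (half b + k).+1 * gram n S b k b' l)%:P.
have entry k l : (k < len b)%N ->
    (pchain b ((len b).-1 - k))^T *m W *m pchain b' l =
    ((-1) ^+ (half b + k).+1 * gram n S b k b' l)%:P%:M.
  move=> hk; rewrite -!(map_chain _ _ (@polyC C)) map_trmx -!map_mxM.
  apply/matrixP => i j; rewrite !ord1 [LHS]mxE [RHS]mxE eqxx mulr1n; congr (_%:P).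
  by rewrite /gram mulmxA chain_sympl // -!scalemxAl !mxE mulrA -expr2 sqrr_sign mul1r.
have -> : chain_cogen b *m (W *m chain_gen b') =
    (\sum_(0 <= k < len b) \sum_(0 <= l < len b') F k l)%:M.
  rewrite /chain_cogen big_nat_rev /= mulmx_suml [RHS]raddf_sum big_nat [RHS]big_nat.
  apply: eq_bigr => k /andP[_ hk]; rewrite add0n mulmxA mulmx_sumr [RHS]raddf_sum.
  apply: eq_bigr => l _; rewrite -!scalemxAl -scalemxAr.
  have -> : (len b - k.+1 = (len b).-1 - k)%N by lia.
  rewrite entry // !scale_scalar_mx /F exprD mulrA.
  have -> : ((len b).-1 - ((len b).-1 - k) = k)%N by lia.
  by [].
congr (_%:M); rewrite (sum_antidiag_support (N := minn (len b) (len b'))).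
- rewrite /antidiag_poly mulr_sumr; apply: eq_bigr => s _.
  rewrite /antidiag rmorph_sum mulr_suml mulr_sumr big_mkord; apply: eq_bigr => k _.
  have hk : (k <= s)%N by rewrite -ltnS.
  rewrite /F subnKC // !rmorphM !rmorphXn rmorphN1 -addSn exprD; ring.
- exact: geq_minl.
- exact: geq_minr.
- by move=> k l hk hl hkl; rewrite /F slice_dir_support // mulr0 polyC0 mulr0.
Qed.

Lemma cogen_second b b' :
  chain_cogen b *m (W *m tail_mx *m W *m chain_gen b') =
  (if b || b' then 0 else zc%:P ^+ 2 * 'X^(2 * (m - n).-1))%:M.
Proof.
have p0 : (0 < m - n)%N by lia.
have tri (u : 'rV[A]_(m + m)) (v w x : 'cV[A]_(m + m)) :
    u *m (v *m w^T *m x) = (u *m v) *m (w^T *m x) by rewrite !mulmxA.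
rewrite lift_dir_second // -scalemxAl -scalemxAr tri.
have h1 : (m - n < len false)%N by rewrite /chain_len /=; lia.
have h2 : ((m - n).-1 < len false)%N by rewrite /chain_len /=; lia.
rewrite cogen_chain // chain_gen_coef //.
case: b; case: b' => /=; rewrite ?raddf0 ?mulmx0 ?mul0mx ?scaler0 //.
rewrite -scalar_mxM scale_scalar_mx -exprD; congr (_ * 'X^_)%:M.
by rewrite /chain_len /=; lia.
Qed.

Lemma even_monic_antidiag b :
  'X^(len b) + (-1) ^+ half b * antidiag_poly b b =
  even_monic (half b) (if b then a else d).
Proof.
rewrite /even_monic /chain_len -mul2n; congr (_ + _).
set c := if b then a else d.
rewrite /antidiag_poly minnn.
have -> : \sum_(0 <= s < len b) (antidiag n S b b s)%:P * 'X^s =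
   \sum_(0 <= s < len b) (if odd s then 0 else
      ((-1) ^+ s./2 * c (half b - s./2)%N)%:P * 'X^(2 * s./2)) :> A.
  apply: eq_big_nat => s /andP[_ hs]; rewrite antidiag_dir_diag //.
  case: ifP => os; first by rewrite polyC0 mul0r.
  by congr (_ * 'X^_); lia.
rewrite (sum_even (fun j => ((-1) ^+ j * c (half b - j)%N)%:P * 'X^(2 * j))).
rewrite big_add1 /= [RHS]big_nat_rev /= mulr_sumr; apply: eq_big_nat => j /andP[_ hj].
rewrite add0n subnSK // -mul_polyC mulrA.
have -> : (half b - (half b - j) = j)%N by lia.
congr (_ * _); rewrite !rmorphM !rmorphXn rmorphN1 mulrA; congr (_ * _).
by rewrite -exprD -[LHS]signr_odd -[RHS]signr_odd oddD oddB 1?ltnW.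
Qed.

Lemma minn_len_cross b b' : b != b' -> minn (len b) (len b') = n.*2.
Proof. by move: hn; rewrite /chain_len /chain_half; case: b; case: b' => //= h _; lia. Qed.

Lemma antidiag_poly_cross : antidiag_poly false true = polyB n y z.
Proof.
rewrite /antidiag_poly minn_len_cross // /polyB.
have E s : (s < n.*2)%N -> antidiag n S false true s =
    (-1) ^+ s * (if (s < n)%N then (-1) ^+ s * y s.+1 else (-1) ^+ n.-1 * z (s - n).+1).
  by move=> hs; rewrite -(antidiag_dir_cross hn a y z d) // antidiag_swap //; exact: sp_slice_dir.
rewrite (big_cat_nat (n := n)) //=; last by rewrite -addnn leq_addr.
congr (_ + _).
  rewrite big_add1 /=; apply: eq_big_nat => s /andP[_ hs].
  rewrite E; last lia.
  by rewrite hs mulrA -expr2 sqrr_sign mul1r mul_polyC.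
rewrite big_add1 /= mulr_sumr -sumrN -{1}[n]add0n big_addn.
rewrite (_ : n.*2 - n = n)%N; last by rewrite -addnn addnK.
apply: eq_big_nat => s /andP[_ hs]; rewrite E; last lia.
rewrite ifF; last lia.
rewrite addnK -!mul_polyC !rmorphM !rmorphXn rmorphN1.
have -> : 'X^(s + n) = 'X^s * 'X^n :> A by rewrite exprD.
have -> : (-1) ^+ (s + n) = - (-1) ^+ s * (-1) ^+ n.-1 :> A.
  have en : n = n.-1.+1 by lia.
  by rewrite [in LHS]en addnS exprS exprD mulN1r mulNr.
have sq : (-1) ^+ n.-1 * (-1) ^+ n.-1 = 1 :> A by rewrite -expr2 sqrr_sign.
transitivity (- ((-1) ^+ n.-1 * (-1) ^+ n.-1) * ((-1) ^+ s * (z s.+1)%:P * 'X^s * 'X^n)).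
  by ring.
by rewrite sq; ring.
Qed.

Lemma antidiag_poly_cross_opp : antidiag_poly true false = polyB n y z \Po - 'X.
Proof.
rewrite -antidiag_poly_cross /antidiag_poly !minn_len_cross // raddf_sum /=.
apply: eq_bigr => s _; rewrite comp_polyM comp_polyC comp_Xn_poly.
rewrite (antidiag_swap n true false s (sp_slice_dir hn a y z d)).
by rewrite [(- 'X) ^+ s]exprNn polyCM polyC_exp polyCN polyC1; ring.
Qed.

(** Coefficients of (t - S) (slice_gen b') on the last vectors of the chains. *)
Definition reduced_entry b b' : A :=
  match b, b' with
  | false, false => even_monic (m - n) d - zc%:P ^+ 2 * 'X^(2 * (m - n).-1)
  | true, true => even_monic n a
  | true, false => (-1) ^+ n * (polyB n y z \Po - 'X)
  | false, true => (-1) ^+ (m - n) * polyB n y z end.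

Lemma res_dir_gen b' : (res_mx - W) *m slice_gen m n a y z d b' =
  \sum_(b : bool) reduced_entry b b' *: chain_last b.
Proof.
rewrite res_slice_gen //.
have -> : 'X^(len b') *: chain_last b' =
    \sum_(b : bool) (if b == b' then 'X^(len b') else 0) *: chain_last b.
  rewrite (bigD1 b') //= eqxx big1 ?addr0 // => b /negbTE ->.
  by rewrite scale0r.
rewrite -sumrB; apply: eq_bigr => b _.
rewrite [_ *m (_ + _)]mulmxDr cogen_dir_gen cogen_second -raddfD mul_mx_scalar -scalerBl.
congr (_ *: _).
have sgn (x : A) : - ((-1) ^+ (half b).+1 * x) = (-1) ^+ half b * x.
  by rewrite exprS mulN1r mulNr opprK.
rewrite opprD addrA sgn /reduced_entry.
case: b sgn => _; case: b' => /=.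
- by rewrite subr0 -(even_monic_antidiag true).
- by rewrite subr0 add0r antidiag_poly_cross_opp.
- by rewrite subr0 add0r antidiag_poly_cross.
- by rewrite -(even_monic_antidiag false).
Qed.

End CharacteristicPolynomial.

(** * The characteristic polynomial *)

Section CharPolySlice.
Variables (R : realType) (m n : nat) (hn : (n.*2 <= m)%N) (m0 : (0 < m)%N).
Local Notation C := R[i].
Local Notation A := {poly R[i]}.
Local Notation pchain := (chain m n A).
Local Notation X := (nilX R hn).
Local Notation liftP := (map_mx (@polyC C)).
Implicit Types (a y z d : nat -> C).

Lemma chain_head_slice_gen a y z d b b' : (0 < chain_len m n b)%N ->
  (pchain b 0)^T *m slice_gen m n a y z d b' = (b == b')%:R%:M.
Proof.
move=> hb; rewrite /slice_gen mulmxDr chain_gen_coef // mulmxA chain_head_tail //.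
by rewrite mul0mx addr0; case: (b == b').
Qed.

(** For n = 0 there is only one chain and the reduced matrix has size 1; the formula
    still holds since then A = 1 and B = 0. *)
Lemma slice_char_dvd a y z d :
  reduced_entry m n a y z d false false * reduced_entry m n a y z d true true
  - reduced_entry m n a y z d false true * reduced_entry m n a y z d true false
  %| char_poly (X + slice_dir m n a y z d).
Proof.
set Df := reduced_entry m n a y z d.
have hp : (0 < chain_len m n false)%N by rewrite /chain_len /=; lia.
have -> : char_poly (X + slice_dir m n a y z d) =
    \det (res_mx R hn - liftP (slice_dir m n a y z d)).
  by rewrite /char_poly /char_poly_mx map_mxD opprD addrA.
have [n0|n0] := posnP n.
  have len0 : chain_len m n true = 0%N by rewrite /chain_len /= n0.
  have B0 : polyB n y z = 0.
    rewrite /polyB n0 !big_geq // mulr0 subr0 //.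
  have -> : Df true true = 1 by rewrite /Df /reduced_entry n0 /even_monic big_geq // addr0.
  have -> : Df false true = 0 by rewrite /Df /reduced_entry B0 mulr0.
  rewrite mul0r subr0 mulr1.
  have -> : Df false false = \det ((Df false false)%:M : 'M[A]_1).
    by rewrite det_mx11 mxE eqxx.
  rewrite (@det_reduction _ _ _ _ (slice_gen m n a y z d false) (pchain false 0)
    (chain_last R m n false) (pchain false 0)^T (Df false false)%:M).
  - exact: dvdp_mulIr.
  - rewrite res_dir_gen // big_bool mul_mx_scalar.
    by rewrite {1}/chain_last /chain len0 /= scaler0 add0r.
  - by rewrite chain_orth // hp.
  - by rewrite chain_head_slice_gen.
have hq : (0 < chain_len m n true)%N by rewrite /chain_len /=; lia.
have s0 : (0 : A)%:M = 0 :> 'M[A]_1 by apply/matrixP => i j; rewrite !mxE mul0rn.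
rewrite -det_block11.
pose F0 : 'M[A]_(m + m, 1 + 1) := row_mx (pchain false 0) (pchain true 0).
rewrite (@det_reduction _ _ _ _ (row_mx (slice_gen m n a y z d false) (slice_gen m n a y z d true))
  F0 (row_mx (chain_last R m n false) (chain_last R m n true)) F0^T
  (block_mx (Df false false)%:M (Df false true)%:M (Df true false)%:M (Df true true)%:M)).
- exact: dvdp_mulIr.
- rewrite mul_mx_row !res_dir_gen // mul_row_block !mul_mx_scalar !big_bool.
  by congr row_mx; rewrite /= addrC.
- rewrite /F0 tr_row_mx mul_col_row !chain_orth //= hp hq.
  by rewrite s0 [RHS]scalar_mx_block.
- rewrite /F0 tr_row_mx mul_col_row !chain_head_slice_gen //=.
  by rewrite s0 [RHS]scalar_mx_block.
Qed.

Lemma even_monicP k (c : nat -> C) :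
  even_monic k c \is monic /\ size (even_monic k c) = (2 * k).+1.
Proof.
rewrite /even_monic; set q := \sum_(_ <= _ < _) _.
have hq : (size q < size ('X^(2 * k) : A))%N.
  rewrite size_polyXn ltnS /q big_nat.
  apply: (big_ind (fun p : A => size p <= 2 * k)%N) => [|p1 p2 h1 h2|i /andP[h1 h2]].
  - by rewrite size_poly0.
  - by apply: leq_trans (size_polyD _ _) _; rewrite geq_max h1.
  - by apply: leq_trans (size_scale_leq _ _) _; rewrite size_polyXn; lia.
by rewrite size_polyDl // size_polyXn monicE lead_coefDl // lead_coefXn eqxx.
Qed.

Lemma size_polyB y z : (size (polyB n y z) <= n.*2)%N.
Proof.
have sz (c : nat -> C) : (size (\sum_(1 <= i < n.+1) c i *: 'X^(i.-1) : A)%R <= n)%N.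
  rewrite big_nat.
  apply: (big_ind (fun p : A => size p <= n)%N) => [|p1 p2 h1 h2|i /andP[h1 h2]].
  - by rewrite size_poly0.
  - by apply: leq_trans (size_polyD _ _) _; rewrite geq_max h1.
  - by apply: leq_trans (size_scale_leq _ _) _; rewrite size_polyXn; lia.
apply: leq_trans (size_polyD _ _) _; rewrite geq_max size_polyN.
apply/andP; split; first by apply: leq_trans (sz _) _; lia.
apply: leq_trans (size_polyMleq _ _) _; rewrite size_polyXn /=.
by rewrite -addnn leq_add2l; exact: sz (fun i => (-1) ^+ i.-1 * z i).
Qed.

(** The second order term -z_n^2 t^(2(m-n-1)) compensates the shift of d_1. *)
Lemma even_monic_corner z d :
  even_monic (m - n) (fun j => if (n.*2 == m) && (j == 1%N) then d 1%N - z n ^+ 2 else d j)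
  - (z_cross m n z)%:P ^+ 2 * 'X^(2 * (m - n).-1) = even_monic (m - n) d :> A.
Proof.
have p0 : (1 < (m - n).+1)%N by lia.
rewrite /even_monic !(big_ltn p0) -!addrA; congr (_ + _); rewrite andbT /z_cross.
rewrite addrA addrAC; congr (_ + _); last first.
  by apply: eq_big_nat => i hi; rewrite (_ : (i == 1)%N = false) ?andbF //; lia.
rewrite subn1 expr1 -mul_polyC; case: eqP => _; last first.
  by rewrite polyC0 expr0n mul0r subr0 -mul_polyC.
rewrite -[RHS]mul_polyC -polyC_exp -mulrBl -polyCB; congr (_%:P * _).
by ring.
Qed.

(** Divisor and multiple are both monic of degree 2m, because B(t)B(-t) has degree
    less than 2m. *)
Theorem char_poly_slice a y z d : char_poly (slice_mx hn a y z d) =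
  even_monic n a * even_monic (m - n) d
  + (-1) ^+ m.+1 *: (polyB n y z * (polyB n y z \Po - 'X)).
Proof.
rewrite slice_mx_dir //; set d' := (fun j => _).
have := slice_char_dvd a y z d'; rewrite /reduced_entry even_monic_corner.
set B := polyB n y z; set B' := B \Po - 'X.
have -> : even_monic (m - n) d * even_monic n a - (-1) ^+ (m - n) * B * ((-1) ^+ n * B') =
    even_monic n a * even_monic (m - n) d + (-1) ^+ m.+1 *: (B * B').
  rewrite mulrC; congr (_ + _); rewrite -mul_polyC polyC_exp polyCN polyC1.
  have -> : m.+1 = ((m - n) + n).+1 by rewrite (blocks_size hn).
  by rewrite exprS exprD; ring.
set P := _ + _ => hdvd.
have [mA sA] := even_monicP n a; have [mD sD] := even_monicP (m - n) d.
have sAD : size (even_monic n a * even_monic (m - n) d) = (m + m).+1.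
  by rewrite size_Mmonic ?monic_neq0 // sA sD; lia.
have sB : (size ((-1) ^+ m.+1 *: (B * B'))%R < size (even_monic n a * even_monic (m - n) d)%R)%N.
  rewrite sAD; apply: leq_ltn_trans (size_scale_leq _ _) _.
  apply: leq_ltn_trans (size_polyMleq _ _) _.
  have hB : (size B <= n.*2)%N := size_polyB y z.
  have hB' : (size B' <= n.*2)%N.
    by rewrite /B' size_comp_poly2 // size_polyN size_polyX.
  apply: (@leq_ltn_trans (n.*2 + n.*2).-1); last by move: hn m0; lia.
  by rewrite -!subn1 leq_sub2r // leq_add.
have mP : P \is monic by rewrite monicE lead_coefDl // -monicE monicMl.
apply/eqP; rewrite eq_sym -eqp_monic ?char_poly_monic // -dvdp_size_eqp //.
by rewrite size_polyDl // sAD size_char_poly.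
Qed.

End CharPolySlice.

Theorem proposition9 (R : realType) (m n : nat)
    (hm : (1 <= m)%N) (hn : (n.*2 <= m)%N) :
  [/\ affine_subspace (slice_set R hn),
      lambda_invariant (ssH R hn) (slice_set R hn),
      transverse_slice (nilX R hn) (slice_set R hn)
    & forall a y z d : nat -> R[i],
        char_poly (slice_mx hn a y z d)
        = even_monic n a * even_monic (m - n) d
          + (-1) ^+ m.+1 *: (polyB n y z * (polyB n y z \Po - 'X))].
Proof.
split.
- exists (nilX R hn), (@slice_directions R m n).
  by split; [exact: linear_slice_directions | exact: slice_setE].
- exact: slice_lambda_invariant.
- exact: slice_transverse.
- by move=> a y z d; exact: char_poly_slice.
Qed.
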